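(* Let $d:\mathfrak W_\Phi\to V^*$ be a semistable complementary polyhedron of the root system $\Phi$ in the Euclidean space $(V,\langle\cdot,\cdot\rangle)$, with convex hull $F=\mathrm{conv}\{d(\mathfrak c)\mid\mathfrak c\in\mathfrak W_\Phi\}$. Then $d$ is polystable if and only if $0\in\mathrm{relint}(F)$.
   Context: Let $(V,\langle\cdot,\cdot\rangle)$ be a finite-dimensional real inner product space and $\Phi\subset V$ a root system (finite, reduced, crystallographic, spanning $V$) with reflections $s_\alpha$. Weyl chambers are the connected components of $V\setminus\bigcup_{\alpha\in\Phi}\alpha^\perp$, and $\mathfrak W_\Phi$ is the set of Weyl chambers. Facets: $v,w\in V$ lie in the same facet iff for every $\alpha\in\Phi$ the numbers $\langle\alpha,v\rangle,\langle\alpha,w\rangle$ are both zero, both positive or both negative. Weyl chambers and $\{0\}$ are facets. For facets, $P\geq Q$ means $P\subset\mathrm{cl}(Q)$ (closure in $V$); $-P$ is the facet opposite to $P$. A fundamental dominant weight is $\lambda\in V$ for which there are a set of simple roots $\triangle\subset\Phi$ and $\alpha\in\triangle$ with $\langle\alpha,\lambda\rangle=1$ and $\langle\beta,\lambda\rangle=0$ for all $\beta\in\triangle\setminus\{\alpha\}$. For a facet $P$, $\mathrm{vert}(P)$ is the set of fundamental dominant weights lying in $\mathrm{cl}(P)$. A map $d:\mathfrak W_\Phi\to V^*$ is a complementary polyhedron if: (A1) $d(\mathfrak c)(\lambda)=d(\mathfrak d)(\lambda)$ for all chambers $\mathfrak c,\mathfrak d$ and all $\lambda\in\mathrm{vert}(\mathfrak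 c)\cap\mathrm{vert}(\mathfrak d)$; (A2) $d(\mathfrak c)(\alpha)\leq d(\mathfrak d)(\alpha)$ whenever $\alpha\in\Phi$ and $\mathfrak c$ is $\alpha$-conjugate to $\mathfrak d$, i.e. $\mathfrak c$ is positive with respect to $\alpha$, $\mathfrak d$ is negative with respect to $\alpha$, and $\mathfrak d=s_\alpha(\mathfrak c)$. Levi-factor: identify $V\cong V^*$ by $v\mapsto\langle v,\cdot\rangle$. For a facet $P$, let $\mathrm{pr}_P:V\to P^\perp$ be the orthogonal projection, and $\check P^\perp\subset V^*$ the image of $P^\perp$, with corresponding projection $\check{\mathrm{pr}}_P:V^*\to\check P^\perp\cong(P^\perp)^*$. Then $\Phi_P=\Phi\cap P^\perp$ is a root system of $P^\perp$, its chambers are the $\mathrm{pr}_P(\mathfrak c)$ for chambers $\mathfrak c$ of $\Phi$ with $P\geq\mathfrak c$ (bijectively), and the Levi-factor $d_P:\mathfrak W_{\Phi_P}\to\check P^\perp$, $d_P(\mathrm{pr}_P(\mathfrak c))=\check{\mathrm{pr}}_P(d(\mathfrak c))$, is a complementary polyhedron of $\Phi_P$. Stability: for a facet $P$ let $R(P)=\{\alpha\in\Phi\mid\langle\alpha,\lambda\rangle\geq0\ \forall\lambda\in\mathrm{vert}(P)\}$ and $\deg(P)=\sum_{\alpha\in R(P)}d(\mathfrak c)(\alpha)$ for any chamber $\mathfrak c$ with $P\geq\mathfrak c$ (independent of $\mathfrak c$). $d$ is semistable if $\deg(P)\leq0$ for all facets $P\neq\{0\}$. $d$ is polystable if for all facets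 $P$ with $\deg(P)=0$: (P1) $d_P$ is a semistable complementary polyhedron of $\Phi_P$; (P2) $\deg(-P)=0$. $\mathrm{relint}(F)$ denotes the relative interior of the convex set $F$, i.e. its interior in its affine hull. *)

(* Defs.v *)
From HB Require Import structures.
From mathcomp Require Import all_boot all_order all_algebra finmap.
From mathcomp Require Import sesquilinear.
From mathcomp Require Import mathcomp_extra boolp classical_sets functions.
From mathcomp Require Import cardinality fsbigop reals topology convex.

Set Implicit Arguments.
Unset Strict Implicit.
Unset Printing Implicit Defensive.

Import Order.TTheory GRing.Theory Num.Theory.

Local Open Scope classical_set_scope.
Local Open Scope ring_scope.

(* Alias of [V] carrying the metric topology of [ip]; an abstract [vectType] has
   no topology of its own. *)
Definition euclidean (R : realType) (V : vectType R) (ip : {dot V for idfun})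
  : Type := V.

Section EuclideanTopology.
Context {R : realType} {V : vectType R} (ip : {dot V for idfun}).

Definition eball (x : V) (e : R) : set V :=
  [set y | ip (y - x) (y - x) < e ^+ 2].

Definition eopen : set (set V) :=
  [set A | forall x, A x -> exists2 e : R, 0 < e & eball x e `<=` A].

Let eopenT : eopen setT.
Proof. by move=> x _; exists 1. Qed.

Let eopenI : setI_closed eopen.
Proof.
move=> A B oA oB x [/oA[e e0 eA] /oB[f f0 fB]].
exists (Num.min e f); first by rewrite lt_min e0.
move=> y; rewrite /eball /= => xy; split; [apply: eA|apply: fB];
  apply: (lt_le_trans xy); rewrite lerXn2r ?nnegrE ?ge_min ?lexx ?orbT //;
  by rewrite ?ltW // lt_min e0.
Qed.

Let eopen_bigU (I : Type) (f : I -> set V) :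
  (forall i, eopen (f i)) -> eopen (\bigcup_i f i).
Proof.
move=> of_ x [i _ fix_]; have [e e0 ef] := of_ i x fix_.
by exists e => // y /ef fiy; exists i.
Qed.

HB.instance Definition _ := Choice.copy (euclidean ip) V.
HB.instance Definition _ := @isOpenTopological.Build (euclidean ip)
  eopen eopenT eopenI eopen_bigU.

End EuclideanTopology.

Definition cl (R : realType) (V : vectType R) (ip : {dot V for idfun})
  (A : set V) : set V := closure (A : set (euclidean ip)).

Section Hulls.
Context {R : realType} {V : vectType R}.

Definition convex_hull (A : set V) : set V := smallest (@convex_set R V) A.

Definition affine_set (A : set V) :=
  forall (x y : V) (t : R), A x -> A y -> A (t *: x + (1 - t) *: y).

Definition affine_hull (A : set V) : set V := smallest affine_set A.

Definition relint (ip : {dot V for idfun}) (F : set V) : set V :=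
  interior (F : set (subspace (affine_hull F : set (euclidean ip)))).

End Hulls.

Section SubDot.
Context {R : realType} {V : vectType R} (ip : {dot V for idfun}).
Variable W : {vspace V}.

Definition sub_dot (x y : subvs_of W) : R := ip (vsval x) (vsval y).

Let sub_dot_bilinear : bilinear_for *%R (idfun \; *%R) sub_dot.
Proof.
by split=> u a x y; rewrite /sub_dot linearP ?linearPl ?linearPr.
Qed.

Let sub_dot_sym x y : sub_dot x y = (-1) ^+ false * idfun (sub_dot y x).
Proof. exact: hermC. Qed.

Let sub_dot_gt0 x : x != 0 -> 0 < sub_dot x x.
Proof. by move=> x0; apply: neq0_dnorm_gt0. Qed.

HB.instance Definition _ := @bilinear_isBilinear.Build R _ _ _ _ _
  sub_dot sub_dot_bilinear.
HB.instance Definition _ := @isHermitianSesquilinear.Build R _ _ _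
  sub_dot sub_dot_sym.
HB.instance Definition _ := @isDotProduct.Build R _ sub_dot sub_dot_gt0.

End SubDot.
Arguments sub_dot {R V} ip W x y.

Section Perp.
Context {R : realType} {V : vectType R} (ip : {dot V for idfun}).

Lemma perp_subproof (P : set V) : exists W : {vspace V},
  forall v, v \in W <-> forall p, P p -> ip v p = 0.
Proof.
pose S (W : {vspace V}) := forall v, v \in W -> forall p, P p -> ip v p = 0.
pose D n := `[< exists2 W, S W & \dim W = n >].
have D0 : exists n, D n.
  exists 0; apply/asboolP; exists 0%VS; rewrite ?dimv0 // => v.
  by rewrite memv0 => /eqP-> p _; rewrite linear0l.
have Dle n : D n -> (n <= \dim {:V})%N.
  by move=> /asboolP[W _ <-]; exact: dimvS (subvf W).
case: (ex_maxnP D0 Dle) => n /asboolP[W SW dimW] maxn.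
exists W => v; split=> [|Pv]; first exact: SW.
have SWv : S (W + <[v]>)%VS.
  move=> _ /memv_addP[w wW [_ /vlineP[k ->] ->]] p Pp.
  by rewrite linearDl linearZl_LR /= SW // Pv // mulr0 addr0.
have := maxn _ (asboolT (ex_intro2 _ _ _ SWv erefl)); rewrite -dimW => le.
have /eqP -> : W == (W + <[v]>)%VS by rewrite eqEdim addvSl.
by rewrite (subvP (addvSr _ _)) ?memv_line.
Qed.

Definition perp (P : set V) : {vspace V} := projT1 (cid (perp_subproof P)).

Lemma perpP P v : v \in perp P <-> forall p, P p -> ip v p = 0.
Proof. by rewrite /perp; case: cid. Qed.

Definition oproj (W : {vspace V}) (v : V) : subvs_of W :=
  vsproj W (daddv_pi W (orthov ip W) v).

End Perp.

Section Dual.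
Context {R : realType} {V : vectType R} (ip : {dot V for idfun}).

Definition flat_fun (v : V) : 'Hom(V, R^o) := linfun (ip v : V -> R^o).

Let flat_funE v x : flat_fun v x = ip v x.
Proof. by rewrite lfunE. Qed.

Let flat_fun_linear : linear flat_fun.
Proof.
move=> a u v; apply/lfunP => x.
by rewrite add_lfunE scale_lfunE !flat_funE linearPl.
Qed.

HB.instance Definition _ :=
  GRing.isLinear.Build R V 'Hom(V, R^o) _ flat_fun flat_fun_linear.

(* [V] is identified with its dual through [flat], with inverse [sharp];
   [dual_dot] below transports [ip] along it and topologizes the dual. *)
Definition flat : 'Hom(V, 'Hom(V, R^o)) := linfun flat_fun.

Definition sharp : 'Hom('Hom(V, R^o), V) := (flat^-1)%VF.

Lemma flatE v x : flat v x = ip v x.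
Proof. by rewrite lfunE. Qed.

Lemma lker_flat : lker flat == 0%VS.
Proof.
rewrite -subv0; apply/subvP => v; rewrite memv_ker memv0 => /eqP fv0.
apply/contraT => /(@neq0_dnorm_gt0 _ _ _ ip).
by rewrite -flatE fv0 lfunE ltxx.
Qed.

Lemma flatK : cancel flat sharp.
Proof. exact/lker0_lfunK/lker_flat. Qed.

Lemma sharpK : cancel sharp flat.
Proof.
move=> f; apply: limg_lfunVK; have -> : limg flat = fullv; last exact: memvf.
apply/eqP; rewrite eqEdim subvf limg_dim_eq; last first.
  by rewrite (eqP lker_flat) capv0.
by rewrite !dimvf /dim /= muln1.
Qed.

Definition dual_dot (f g : 'Hom(V, R^o)) : R := ip (sharp f) (sharp g).

Let dual_dot_bilinear : bilinear_for *%R (idfun \; *%R) dual_dot.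
Proof.
by split=> u a x y; rewrite /dual_dot linearP ?linearPl ?linearPr.
Qed.

Let dual_dot_sym f g : dual_dot f g = (-1) ^+ false * idfun (dual_dot g f).
Proof. exact: hermC. Qed.

Let dual_dot_gt0 f : f != 0 -> 0 < dual_dot f f.
Proof.
move=> f0; apply: neq0_dnorm_gt0; apply: contra_neq f0 => sf0.
by rewrite -[f]sharpK sf0 linear0.
Qed.

HB.instance Definition _ := @bilinear_isBilinear.Build R _ _ _ _ _
  dual_dot dual_dot_bilinear.
HB.instance Definition _ := @isHermitianSesquilinear.Build R _ _ _
  dual_dot dual_dot_sym.
HB.instance Definition _ := @isDotProduct.Build R _ dual_dot dual_dot_gt0.

End Dual.

(* The projection of the dual of [V] onto the image of [W] under [flat ip],
   followed by the identification of that image with the dual of [W]. *)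
Definition dual_oproj (R : realType) (V : vectType R) (ip : {dot V for idfun})
    (W : {vspace V}) (f : 'Hom(V, R^o)) : 'Hom(subvs_of W, R^o) :=
  flat (sub_dot ip W) (oproj ip W (sharp ip f)).

Section RootSystem.
Context {R : realType} {V : vectType R} (ip : {dot V for idfun}).
Implicit Types (Phi P Q C D : set V) (a b v w l : V).

Definition reflection a v : V := v - (2 * ip a v / ip a a) *: a.

Record root_system Phi : Prop := {
  root_finite : finite_set Phi ;
  root_neq0 : ~ Phi 0 ;
  root_span : forall v, exists2 s : seq V, [set` s] `<=` Phi & v \in <<s>>%VS ;
  root_reflection : forall a b, Phi a -> Phi b -> Phi (reflection a b) ;
  root_crystallographic : forall a b, Phi a -> Phi b ->
    2 * ip a b / ip a a \is a Num.int ;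
  root_reduced : forall a (k : R), Phi a -> Phi (k *: a) -> k = 1 \/ k = -1
}.

(* Every root is a combination of the basis [s] with integer coefficients that
   are all nonnegative or all nonpositive; [basis_of] makes [s] duplicate-free,
   so that [s] enumerates a set of simple roots. *)
Definition simple_roots Phi (s : seq V) : Prop :=
  [/\ [set` s] `<=` Phi, basis_of fullv s &
      forall a, Phi a -> exists k : V -> nat,
        a = \sum_(b <- s) b *+ k b \/ a = - \sum_(b <- s) b *+ k b].

Definition regular Phi : set V :=
  ~` \bigcup_(a in Phi) [set v | ip a v = 0].

Definition chambers Phi : set (set V) :=
  [set C | exists2 v, regular Phi v &
    C = connected_component (regular Phi : set (euclidean ip)) v].

Definition same_facet Phi v w : Prop := forall a, Phi a ->
  [\/ ip a v = 0 /\ ip a w = 0, 0 < ip a v /\ 0 < ip a w |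
      ip a v < 0 /\ ip a w < 0].

Definition facets Phi : set (set V) :=
  [set P | exists v, P = [set w | same_facet Phi v w]].

Definition facet_ge P Q : Prop := P `<=` cl ip Q.

Definition facet_opp P : set V := -%R @` P.

Definition fundamental_weight Phi l : Prop :=
  exists s a, [/\ simple_roots Phi s, a \in s, ip a l = 1 &
                  forall b, b \in s -> b != a -> ip b l = 0].

Definition vert Phi P : set V := [set l | fundamental_weight Phi l /\ cl ip P l].

Definition conjugate_chambers a C D : Prop :=
  [/\ forall v, C v -> 0 < ip a v, forall v, D v -> ip a v < 0 &
      D = reflection a @` C].

(* [d] stands for a map on the set of Weyl chambers: its values at other sets
   are never used. *)
Definition complementary_polyhedron Phi (d : set V -> 'Hom(V, R^o)) : Prop :=
  (forall C D l, chambers Phi C -> chambers Phi D ->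
     vert Phi C l -> vert Phi D l -> d C l = d D l) /\
  (forall C D a, chambers Phi C -> chambers Phi D -> Phi a ->
     conjugate_chambers a C D -> (d C a : R) <= d D a).

Definition facet_roots Phi P : set V :=
  [set a | Phi a /\ forall l, vert Phi P l -> 0 <= ip a l].

(* Some chamber whose closure contains [P]; for a complementary polyhedron [deg]
   does not depend on the choice. *)
Definition facet_chamber Phi P : set V :=
  xget set0 [set C | chambers Phi C /\ facet_ge P C].

Definition deg Phi (d : set V -> 'Hom(V, R^o)) P : R :=
  \sum_(a \in facet_roots Phi P) (d (facet_chamber Phi P) a : R).

Definition semistable Phi (d : set V -> 'Hom(V, R^o)) : Prop :=
  forall P, facets Phi P -> P <> [set 0] -> deg Phi d P <= 0.

Definition levi_roots Phi P : set (subvs_of (perp ip P)) :=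
  [set a | Phi (vsval a)].

(* The unique chamber [C] with [facet_ge P C] that projects onto the chamber [D]
   of [levi_roots]. *)
Definition levi_chamber Phi P (D : set (subvs_of (perp ip P))) : set V :=
  xget set0 [set C | [/\ chambers Phi C, facet_ge P C &
                         oproj ip (perp ip P) @` C = D]].

Definition levi Phi (d : set V -> 'Hom(V, R^o)) P
    (D : set (subvs_of (perp ip P))) : 'Hom(subvs_of (perp ip P), R^o) :=
  dual_oproj ip (perp ip P) (d (levi_chamber Phi D)).

End RootSystem.
Arguments levi_roots {R V} ip Phi P.
Arguments levi {R V} ip Phi d P D.

Definition polystable (R : realType) (V : vectType R) (ip : {dot V for idfun})
    (Phi : set V) (d : set V -> 'Hom(V, R^o)) : Prop :=
  forall P, facets ip Phi P -> deg ip Phi d P = 0 ->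
    [/\ complementary_polyhedron (sub_dot ip (perp ip P))
          (levi_roots ip Phi P) (levi ip Phi d P),
        semistable (sub_dot ip (perp ip P))
          (levi_roots ip Phi P) (levi ip Phi d P) &
        deg ip Phi d (facet_opp P) = 0].

(* Main.v *)
Require Import Defs.
From mathcomp Require Import all_boot all_order all_algebra.
From mathcomp Require Import sesquilinear.
From mathcomp Require Import boolp classical_sets reals topology.
From mathcomp Require Import cardinality fsbigop interval_inference.
From mathcomp Require Import normedtype convex ring lra zify.

Set Implicit Arguments.
Unset Strict Implicit.
Unset Printing Implicit Defensive.

Import Order.TTheory GRing.Theory Num.Theory.
Import numFieldNormedType.Exports.

Local Open Scope classical_set_scope.
Local Open Scope ring_scope.

(** For [x] in [V] let [h x] be the minimum of [d C x] over all chambers [C].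
Let [C] be a chamber, [a] one of its simple roots and [C'] its mirror image
under the reflection in [a]. By (A1) the functional [d C' - d C] vanishes on all
fundamental weights of [C] other than the one dual to [a], so it is a multiple
of the pairing with [a], and by (A2) the multiple is nonnegative
([wall_crossing]). Along a gallery from [C] to [D] these steps add up:
[d D - d C] is a nonnegative combination of roots that are positive on [C].
Hence [h x = d C x] for every [x] in the closure of [C] ([polyhedron_min]); in
particular [h] is linear on each closed chamber.

The sum of the roots in [R(P)] is a vector of [P] itself ([facet_sum_facet]), so
the degree of [P] is the value of [h] at a point of [P] ([deg_cell]). For the
ray through a fundamental weight this shows that semistability makes [h]
nonpositive there, hence everywhere ([semistable_le0]). A nonpositive linear
function on a closed simplicial cone that vanishes at a relatively interior
point vanishes on the whole cone ([semistable_vanish]), so [P] has degree [0]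
exactly when [h] vanishes on [P].

Condition (P2) therefore says that [h x = 0] forces [h (- x) = 0], that is, that
a vector whose pairings with all the [d C] are nonnegative pairs to [0] with all
of them: this is [balanced], with [opp_balanced] and [balanced_opp] for the two
directions. By Stiemke's lemma it holds exactly when [0] is a combination of
the [d C] with strictly positive coefficients, which is to say that [0] lies in
the relative interior of their hull ([relint0P]).

Condition (P1) follows from semistability when [P] has degree [0]. Let [p] be in
[P], let [C] be a chamber with [P] in its closure, and let [x], orthogonal to
[P], be in the closure of the projection of [C]. Then [T p + x] is in the
closure of [C] for large [T] ([lift_face]), and [h p = 0], so
[d C x = h (T p + x) <= 0] ([levi_semistable]). The same translation by [T p]
carries (A1) over to the Levi factor, while (A2) is inherited because
reflections in roots orthogonal to [P] fix [P]
([levi_complementary_polyhedron]). *)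

(** * Dot products and the topology they define *)

Section DotProduct.
Context {R : realType} {V : vectType R} (ip : {dot V for idfun}).
Implicit Types u v w : V.
Lemma ipC u v : ip u v = ip v u.
Proof. by rewrite hermC /= expr0 mul1r. Qed.
Lemma ipDl u v w : ip (u + v) w = ip u w + ip v w.
Proof. exact: linearDl. Qed.
Lemma ipZl k u w : ip (k *: u) w = k * ip u w.
Proof. exact: linearZl_LR. Qed.
Lemma ipNl u w : ip (- u) w = - ip u w.
Proof. exact: linearNl. Qed.
Lemma ipDr u v w : ip w (u + v) = ip w u + ip w v.
Proof. exact: linearDr. Qed.
Lemma ipZr k u w : ip w (k *: u) = k * ip w u.
Proof. by rewrite ipC ipZl ipC. Qed.
Lemma ipNr u w : ip w (- u) = - ip w u.
Proof. exact: linearNr. Qed.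
Lemma ip0l w : ip 0 w = 0. Proof. exact: linear0l. Qed.
Lemma ip0r w : ip w 0 = 0. Proof. exact: linear0r. Qed.
Lemma ip_sumr I (r : seq I) P (F : I -> V) w :
  ip w (\sum_(i <- r | P i) F i) = \sum_(i <- r | P i) ip w (F i).
Proof. exact: linear_sumr. Qed.
Lemma ip_suml I (r : seq I) P (F : I -> V) w :
  ip (\sum_(i <- r | P i) F i) w = \sum_(i <- r | P i) ip (F i) w.
Proof. by rewrite ipC ip_sumr; apply: eq_bigr => i _; exact: ipC. Qed.
Lemma ip_gt0 u : u != 0 -> 0 < ip u u.
Proof. exact: neq0_dnorm_gt0. Qed.
Lemma ip_ge0 u : 0 <= ip u u.
Proof. by have [->|/ip_gt0/ltW//] := eqVneq u 0; rewrite ip0l. Qed.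
Lemma ip_eq0 u : ip u u = 0 -> u = 0.
Proof. by move=> h; apply/eqP; apply: contraTT isT => /ip_gt0; rewrite h ltxx. Qed.

Lemma cauchy_schwarz u v : ip u v ^+ 2 <= ip u u * ip v v.
Proof.
have [->|/ip_gt0 v0] := eqVneq v 0; first by rewrite !ip0r expr0n mulr0.
have := ip_ge0 (ip v v *: u - ip u v *: v).
rewrite ipDl !ipDr !ipNl !ipNr !ipZl !ipZr (ipC v u) => h.
rewrite -(ler_pM2l v0); nra.
Qed.

Lemma sharpE (f : 'Hom(V, R^o)) v : ip (sharp ip f) v = f v.
Proof. by rewrite -flatE sharpK. Qed.

Lemma nbhs_eball (x : euclidean ip) (U : set (euclidean ip)) :
  nbhs x U -> exists2 e : R, 0 < e & eball ip x e `<=` U.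
Proof.
rewrite nbhsE => -[B [oB Bx] BU]; have [e e0 eB] := oB _ Bx.
by exists e => //; apply: subset_trans BU.
Qed.

Lemma open_halfspace g c : open ([set w | c < ip g w] : set (euclidean ip)).
Proof.
move=> x /= cx; set G := ip g g; have G0 : 0 <= G := ip_ge0 g.
have G1 : 0 < G + 1 by rewrite ltr_wpDl.
exists ((ip g x - c) / (G + 1)); first by rewrite divr_gt0 ?subr_gt0.
move=> y; rewrite /eball /= expr_div_n ltr_pdivlMr ?exprn_gt0 // => xy.
have := cauchy_schwarz g (y - x); have := ip_ge0 (y - x).
rewrite [ip g (y - x)]ipDr ipNr -/G; set N := ip (y - x) _ in xy *.
move: cx xy; set a := ip g x; set b := ip g y => cx xy N0 h.
rewrite ltNge; apply/negP => bc.
have : (a - c) ^+ 2 <= (b - a) ^+ 2 by nra.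
move=> h2; have : N * G <= N * (G + 1) ^+ 2 by apply: ler_wpM2l => //; nra.
by move=> h3; lra.
Qed.

Lemma closed_halfspace g c : closed ([set w | ip g w <= c] : set (euclidean ip)).
Proof.
rewrite (_ : mkset _ = ~` [set w | c < ip g w]).
  by apply: open_closedC; exact: open_halfspace.
by apply/seteqP; split=> w /=; rewrite leNgt => /negP.
Qed.

Lemma continuous_line v w : continuous ((fun t : R => v + t *: w) : R -> euclidean ip).
Proof.
move=> t U /nbhs_eball[e e0 eU]; set G := ip w w; have G0 : 0 <= G := ip_ge0 w.
have G1 : 0 < G + 1 by rewrite ltr_wpDl.
apply/nbhs_ballP; exists (e / (G + 1)) => /=; first by rewrite divr_gt0.
move=> t' /=; rewrite /ball /= ltr_pdivlMr // => tt'; apply: eU; rewrite /eball /=.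
rewrite (_ : _ - _ = (t' - t) *: w); last by rewrite scalerBl opprD addrACA subrr add0r.
rewrite ipZl ipZr -/G.
have n0 := normr_ge0 (t - t'); move: tt' n0; rewrite mulrA -[_ * (t' - t)]expr2.
rewrite -(real_normK (num_real (t' - t))) distrC; set n := `|_| => h n0.
have h1 : (n * (G + 1)) ^+ 2 < e ^+ 2 by rewrite ltr_pXn2r ?nnegrE ?mulr_ge0 ?(ltW e0) ?(ltW G1).
have h2 : n ^+ 2 * G <= (n * (G + 1)) ^+ 2 by rewrite exprMn ler_wpM2l ?sqr_ge0 //; nra.
lra.
Qed.

(** The bound on [t] is uniform in the centre because balls are translates of
one another. *)
Lemma eball_scale v (e : R) : 0 < e ->
  exists2 t : R, 0 < t & forall w, eball ip w e (w + t *: v).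
Proof.
move=> e0; have G0 := ip_ge0 v; have G1 : 0 < ip v v + 1 by rewrite ltr_wpDl.
have [t t0 te] : exists2 t, 0 < t & t * (ip v v + 1) = e.
  by exists (e / (ip v v + 1)); [rewrite divr_gt0 | rewrite divfK ?gt_eqF].
exists t => // w; rewrite /eball /= addrAC subrr add0r ipZl ipZr -te.
rewrite (_ : t * (t * ip v v) = t ^+ 2 * ip v v); last by ring.
by rewrite exprMn ltr_pM2l ?exprn_gt0 //; nra.
Qed.

(** * The lemmas of Farkas and Stiemke *)

(** A recursive form of the cone of nonnegative combinations of the entries of
[s]; it suits the induction in [farkas] and tolerates repeated entries, which
projections create. *)
Fixpoint cone (s : seq V) (b : V) : Prop :=
  if s is x :: s' then exists2 k : R, 0 <= k & cone s' (b - k *: x) else b = 0.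

Lemma coneP s b : cone s b ->
  exists2 c : nat -> R, forall i, 0 <= c i & b = \sum_(i < size s) c i *: s`_i.
Proof.
elim: s b => [|x s IH] b /=; first by move=> ->; exists (fun=> 0) => //; rewrite big_ord0.
move=> [k k0 /IH[c c0 bk]]; exists (fun i => if i is j.+1 then c j else k).
  by case.
by rewrite big_ord_recl /= -bk addrC subrK.
Qed.

(** A combination of the vectors [y + f y *: x] is one of the vectors [y] up to
a nonnegative multiple of [x]. *)
Lemma cone_map s (f : V -> R) x b : (forall y, y \in s -> 0 <= f y) ->
  cone [seq y + f y *: x | y <- s] b ->
  exists2 k : R, 0 <= k & cone s (b - k *: x).
Proof.
elim: s b => [|y s IH] b /= fs.
  by move=> ->; exists 0; rewrite // scale0r subr0.
move=> [k k0 /IH[z zs|l l0 h]]; first by apply: fs; rewrite inE zs orbT.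
have fy : 0 <= f y by apply: fs; rewrite inE eqxx.
exists (l + k * f y); first by rewrite addr_ge0 ?mulr_ge0.
exists k => //; move: h; congr cone; rewrite scalerDr scalerDl scalerA !opprD.
by rewrite [- (k *: y) + _]addrC [- (l *: x) + _]addrC !addrA [LHS]addrAC.
Qed.

(** Induction on the length of [s], for all vectors at once. If the separating
functional [l] obtained without [x] is negative at [x], project [b] and the other
vectors along [x] onto the kernel of [l]: a cone representation of the projected
[b] lifts with a nonnegative coefficient of [x], and a functional separating the
projected data, composed with the projection, separates the original data. *)
Lemma farkas s b : cone s b \/
  exists2 l, {in s, forall x, 0 <= ip x l} & ip b l < 0.
Proof.
have [n] := ubnP (size s); elim: n s b => // n IH [|x s] b /= sn.
  have [->|b0] := eqVneq b 0; [by left|right].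
  by exists (- b) => //; rewrite ipNr oppr_lt0 ip_gt0.
have [sb|[l ls bl]] := IH s b sn.
  by left; exists 0; rewrite // scale0r subr0.
have [lx|lx] := leP 0 (ip x l).
  by right; exists l => // y; rewrite inE => /orP[/eqP->|/ls].
(* [y + f y *: x] is the projection of [y] along [x] onto the kernel of [l]. *)
pose f y := - (ip y l / ip x l).
have fs y : y \in s -> 0 <= f y.
  by move=> /ls ly; rewrite /f oppr_ge0 ler_ndivrMr // mul0r.
have [|h|[m ms bm]] := IH [seq y + f y *: x | y <- s] (b + f b *: x).
- by rewrite size_map.
- have [k k0 h'] := cone_map fs h; left; exists (k - f b); last first.
    by move: h'; congr cone; rewrite scalerBl opprB addrA addrAC.
  by rewrite subr_ge0 (le_trans _ k0) // /f oppr_le0 ler_ndivlMr // mul0r ltW.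
- right; exists (m + (- (ip x m / ip x l)) *: l).
    move=> y; rewrite inE => /orP[/eqP->|ys]; rewrite ipDr ipZr.
      by rewrite mulNr divfK ?subrr // lt_eqF.
    have := ms _ (map_f _ ys); rewrite ipDl ipZl /f; congr (_ <= _ + _); ring.
  by move: bm; rewrite !ipDr ipDl !ipZr ipZl /f; congr (_ + _ < _); ring.
Qed.

End DotProduct.

Section Hull.
Context {R : realType} {V : vectType R} (ip : {dot V for idfun}).
Implicit Types (u v w : V) (s : seq V).

(** Farkas' lemma puts each [- s`_j] into the cone of [s], since a separating
functional would contradict the hypothesis. Adding the resulting relations over
[j] gives one in which every coefficient is at least [1]. *)
Lemma stiemke s :
  (forall l, {in s, forall x, 0 <= ip x l} -> {in s, forall x, ip x l = 0}) ->
  exists2 c : nat -> R, forall i, 0 < c i & \sum_(i < size s) c i *: s`_i = 0.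
Proof.
move=> H.
have /fin_all_exists[C /all_and2[C0 CE]] : forall j : 'I_(size s),
    exists c : nat -> R, (forall i, 0 <= c i) /\
      - s`_j = \sum_(i < size s) c i *: s`_i.
  move=> j; have sj : s`_j \in s by apply: mem_nth.
  have [/coneP[c c0 cE]|[l ls]] := farkas ip s (- s`_j); first by exists c.
  by rewrite ipNl (H l ls) // oppr0 ltxx.
exists (fun i => 1 + \sum_j C j i).
  by move=> i; rewrite ltr_wpDr // sumr_ge0.
under eq_bigr => i _ do rewrite scalerDl scale1r scaler_suml.
rewrite big_split /= exchange_big /= -big_split big1 // => j _ /=.
by rewrite -CE subrr.
Qed.

(** * The relative interior of a polytope *)

Lemma convex_setP (C : set V) : @convex_set R V C <->
  forall x y (t : R), 0 <= t -> t <= 1 -> C x -> C y -> C (t *: x + (1 - t) *: y).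
Proof.
split=> [cC x y t t0 t1 Cx Cy|cC x y k].
  by have := cC x y (Itv01 t0 t1); rewrite !inE; apply.
by rewrite !inE => Cx Cy; exact: cC.
Qed.

(** Stating Jensen's closure property without normalizing the coefficients makes
the induction go through when the partial sums vanish. *)
Lemma convex_comb (C : set V) y0 n (x : nat -> V) (b : nat -> R) :
    @convex_set R V C -> C y0 -> (forall i, 0 <= b i) ->
    (forall i, (i < n)%N -> C (x i)) ->
  exists2 y, C y & \sum_(i < n) b i *: x i = (\sum_(i < n) b i) *: y.
Proof.
move=> /convex_setP cC Cy0 b0; elim: n => [|n IH] Cx.
  by exists y0 => //; rewrite !big_ord0 scale0r.
have [|y Cy yE] := IH; first by move=> i /ltnW; exact: Cx.
rewrite !big_ord_recr /= yE; set S := \sum_(i < n) b i.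
have S0 : 0 <= S by apply: sumr_ge0.
have [T0|T0] := eqVneq (S + b n) 0.
  have := b0 n; exists y => //; have S_0 : S = 0 by lra.
  have -> : b n = 0 by lra.
  by rewrite S_0 addr0 !scale0r addr0.
have Tp : 0 < S + b n by rewrite lt0r T0 addr_ge0.
exists ((S / (S + b n)) *: y + (1 - S / (S + b n)) *: x n).
  apply: cC => //; last exact: Cx; first by rewrite divr_ge0 // ltW.
  by rewrite ler_pdivrMr // mul1r lerDl.
rewrite scalerDr !scalerA mulrBr mulr1 [(S + b n) * _]mulrC divfK //.
by rewrite addrAC subrr add0r.
Qed.

(** If [0] is relatively interior, small negative multiples of each [x] in [s]
stay in the hull, so a functional that is nonnegative on [s] vanishes on it.
Conversely, Stiemke's lemma writes [0] as a convex combination with positive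
coefficients [c i]; a point [y] of the span with coordinates [g i] is the
combination with coefficients [c i + g i - c i * \sum_j g j], which sum to [1] and
are positive for [y] near [0] because the coordinates are linear in [y]. *)
Lemma relint0P s : s != [::] ->
  relint ip (convex_hull [set` s]) 0 <->
  (forall l, {in s, forall x, 0 <= ip x l} -> {in s, forall x, ip x l = 0}).
Proof.
move=> s0; set F := convex_hull _; pose A := affine_hull F.
have sF x : x \in s -> F x by move=> xs C [_]; exact.
have FA : F `<=` A by move=> x Fx B [_]; exact.
have aA : affine_set A.
  by move=> x y t Ax Ay B [aB FB]; exact: aB (Ax B (conj aB FB)) (Ay B (conj aB FB)).
have hF l : {in s, forall x, 0 <= ip x l} -> forall x, F x -> 0 <= ip x l.
  move=> ls x /(_ [set x | 0 <= ip x l]) /=; apply; split; last exact: ls.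
  apply/convex_setP => y z t t0 t1 /= ly lz.
  by rewrite ipDl !ipZl addr_ge0 // mulr_ge0 // subr_ge0.
split=> [F0 l ls x xs|H].
  have {}F0 : nbhs (0 : subspace (A : set (euclidean ip))) F by exact: F0.
  have A0 : A 0 by apply: FA; exact: (nbhs_singleton F0).
  move: F0 => /(nbhs_subspace_ex _ A0)[U /nbhs_eball[e e0 eU] FU].
  have [t t0 te] := eball_scale ip (- x) e0.
  (* [t *: - x] is the affine combination of [x] and [0] with weights [- t] and
  [1 + t]. *)
  have : F (t *: - x).
    have : (F `&` A) (t *: - x); last by case.
    rewrite FU; split; first by apply: eU; have := te 0; rewrite add0r.
    have := aA _ _ (- t) (FA _ (sF _ xs)) A0.
    by rewrite scaler0 addr0 scalerN scaleNr.
  move=> /(hF _ ls); rewrite ipZl ipNl pmulr_rge0 // => lx.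
  by apply/eqP; rewrite eq_le ls // andbT -oppr_ge0.
have [c c0 cE] := stiemke H.
have n0 : (0 < size s)%N by rewrite lt0n size_eq0.
wlog c1 : c c0 cE / \sum_(i < size s) c i = 1.
  set S := \sum_(i < size s) c i.
  have S0 : 0 < S.
    by rewrite /S (bigD1 (Ordinal n0)) //= ltr_wpDr // sumr_ge0 // => i _; exact: ltW.
  move/(_ (fun i => c i / S)); apply.
  - by move=> i; rewrite divr_gt0.
  - under eq_bigr => i _ do rewrite mulrC -scalerA.
    by rewrite -scaler_sumr cE scaler0.
  - by rewrite -mulr_suml divff // gt_eqF.
have Fcomb (b : 'I_(size s) -> R) : (forall i, 0 <= b i) ->
    \sum_(i < size s) b i = 1 -> F (\sum_(i < size s) b i *: s`_i).
  move=> b0 b1 C [cC sC]; pose b' k := if insub k is Some i then b i else 0.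
  have b'E (i : 'I_(size s)) : b i = b' i by rewrite /b' valK.
  have b'0 i : 0 <= b' i by rewrite /b'; case: insub.
  have sx i : (i < size s)%N -> C (nth 0 s i) by move=> /(mem_nth 0) /sC.
  have [y Cy yE] := convex_comb cC (sx _ n0) b'0 sx.
  under eq_bigr => i _ do rewrite b'E.
  by rewrite yE -(eq_bigr _ (fun i _ => b'E i)) b1 scale1r.
have F0 : F 0 by rewrite -cE; apply: Fcomb => // i; exact: ltW.
have AL y : A y -> y \in <<s>>%VS.
  move=> /(_ [set y | y \in <<s>>%VS]); apply; split=> [u v t /= us vs|x].
    by rewrite memvD // memvZ.
  move=> /(_ [set y | y \in <<s>>%VS]); apply; split; last exact: memv_span.
  by apply/convex_setP => u v t _ _ /= us vs; rewrite memvD // memvZ.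
pose X := in_tuple s.
pose r j := sharp ip (linfun (coord X j : V -> R^o)).
have rE j y : ip (r j) y = coord X j y by rewrite sharpE lfunE.
(* [f i] represents the correction [g i - c i * \sum_j g j] of the coefficient
[c i] as a linear functional of [y]. *)
pose f (i : 'I_(size s)) := r i - c i *: \sum_j r j.
have fE i y : ip (f i) y = coord X i y - c i * \sum_j coord X j y.
  rewrite ipDl ipNl ipZl ip_suml rE; congr (_ - _ * _).
  by apply: eq_bigr => j _.
have : nbhs (0 : subspace (A : set (euclidean ip))) F; last by [].
apply/(nbhs_subspace_ex _ (FA _ F0)).
pose U : set (euclidean ip) := [set y | forall i : 'I_(size s), - c i < ip (f i) y].
have U0 : nbhs (0 : euclidean ip) U.
  apply: (@filter_forall _ _ (fun (i : 'I_(size s)) (y : euclidean ip) =>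
    - c i < ip (f i) y) _ (nbhs_filter (0 : euclidean ip))) => i; apply: open_nbhs_nbhs; split.
    exact: (open_halfspace (ip := ip)).
  by rewrite /= (ip0r ip (f i)) oppr_lt0.
exists (U `|` F); first by apply: filterS U0 => y Uy; left.
apply/seteqP; split=> y [yF Ay]; split=> //; first by right.
case: yF => // Uy; have := coord_span (X := X) (AL _ Ay).
set g := fun i => coord X i y => yE.
have -> : y = \sum_(i < size s) (g i - c i * \sum_j g j + c i) *: s`_i.
  set G := \sum_j g j.
  rewrite {1}yE -[LHS]addr0 -[X in _ + X = _](scaler0 _ (1 - G)).
  rewrite -[X in _ *: X]cE scaler_sumr -big_split /=.
  apply: eq_bigr => i _; rewrite scalerA -scalerDl; congr (_ *: _); ring.
apply: Fcomb => [i|]; first by have := Uy i; rewrite fE; lra.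
rewrite !big_split /= sumrN -mulr_suml c1; lra.
Qed.

End Hull.

(** * Facets and chambers *)

Section Facets.
Context {R : realType} {V : vectType R} (ip : {dot V for idfun}) (Phi : set V).
Implicit Types (a b p q u v w : V).

Definition cell v : set V := [set w | same_facet ip Phi v w].

(** [p] lies in the closure of the facet of [w] (see [cl_cell]). Since the roots
are stable under opposites, comparing the conditions [0 <= ip a _] also controls
the roots that are negative or zero on [w], and two vectors share a facet exactly
when each is a [face] of the other. *)
Definition face p w := forall a, Phi a -> 0 <= ip a w -> 0 <= ip a p.

Lemma face_refl v : face v v. Proof. by []. Qed.

Lemma face_trans v u w : face u v -> face v w -> face u w.
Proof. by move=> uv vw a Pa /(vw a Pa) /(uv a Pa). Qed.

Lemma reflectionE a v : reflection ip a v = v - (2 * ip a v / ip a a) *: a.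
Proof. by []. Qed.

Lemma ip_reflection a v w : a != 0 ->
  ip (reflection ip a v) w = ip v (reflection ip a w).
Proof.
move=> /(ip_gt0 ip) a0; rewrite /reflection ipDl ipDr ipNl ipNr ipZl ipZr.
by rewrite (ipC ip v a); congr (_ - _); ring.
Qed.

Lemma reflectionK a : a != 0 -> involutive (reflection ip a).
Proof.
move=> /(ip_gt0 ip) a0 v; rewrite /reflection -addrA -opprD -scalerDl.
rewrite -[RHS]subr0 -[X in _ = _ - X](scale0r a); congr (_ - _ *: _).
rewrite ipDr ipNr ipZr; field.
by rewrite gt_eqF.
Qed.

Lemma reflection_self a : a != 0 -> reflection ip a a = - a.
Proof.
move=> /(ip_gt0 ip) a0; rewrite /reflection mulfK ?gt_eqF //.
by rewrite scaler_nat mulr2n opprD addrA subrr sub0r.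
Qed.

Lemma face_reflection a p w : a != 0 -> (forall b, Phi b -> Phi (reflection ip a b)) ->
  face p w -> face (reflection ip a p) (reflection ip a w).
Proof.
move=> a0 aPhi pw b Pb; rewrite -!ip_reflection //; exact/pw/aPhi.
Qed.

Hypothesis PhiN : forall a, Phi a -> Phi (- a).

Lemma same_facetP v w : same_facet ip Phi v w <-> face v w /\ face w v.
Proof.
split=> [vw|[vw wv] a Pa].
  by split=> a /vw[[-> ->]|[/ltW x /ltW y]|[x y]] //; rewrite leNgt ?x ?y.
have := vw _ Pa; have := wv _ Pa; have := vw _ (PhiN Pa); have := wv _ (PhiN Pa).
rewrite !ipNl !oppr_ge0.
case: (ltgtP (ip a v) 0) => [x|x|->]; case: (ltgtP (ip a w) 0) => [y|y|->];
  rewrite ?lexx => h1 h2 h3 h4; try by [constructor 1|constructor 2|constructor 3];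
  first [by have := h1 isT|by have := h2 isT|by have := h3 isT|by have := h4 isT].
Qed.

Lemma cell_eq v w : face v w -> face w v -> cell v = cell w.
Proof.
move=> vw wv; apply/seteqP; split=> u /same_facetP[h1 h2]; apply/same_facetP.
  by split; [exact: face_trans wv h1 | exact: face_trans h2 vw].
by split; [exact: face_trans vw h1 | exact: face_trans h2 wv].
Qed.

Lemma cell_self v : cell v v. Proof. by apply/same_facetP; split; exact: face_refl. Qed.

(** A closed half-space that contains [p] and not [w] would separate [w] from the
facet; conversely [w + t *: p] is in the facet of [p] for all [t > 0]. *)
Lemma cl_cell p w : cl ip (cell p) w <-> face w p.
Proof.
split=> [clw a Pa ap|wp B /nbhs_eball[e e0 eB]].
  rewrite leNgt; apply/negP => aw.
  have [|x []] := clw [set y | 0 < ip (- a) y].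
    apply: open_nbhs_nbhs; split; first exact: (open_halfspace (ip := ip)).
    by rewrite /= ipNl oppr_gt0.
  by move=> /same_facetP[_ /(_ a Pa ap)] /=; rewrite ipNl oppr_gt0 leNgt => /negP.
have [t t0 te] := eball_scale ip p e0.
exists (w + t *: p); split; last exact: eB.
apply/same_facetP; split=> a Pa; rewrite ipDr ipZr => h.
  rewrite leNgt; apply/negP => ap.
  have := wp _ (PhiN Pa); rewrite !ipNl !oppr_ge0 => /(_ (ltW ap)) aw.
  have : t * ip a p < 0 by rewrite pmulr_rlt0.
  lra.
by rewrite addr_ge0 ?wp // mulr_ge0 // ltW.
Qed.

Lemma facet_ge_cell p w : facet_ge ip (cell p) (cell w) <-> face p w.
Proof.
split=> [|pw x /same_facetP[_ xp]]; first by move/(_ _ (cell_self p))/cl_cell.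
by apply/cl_cell; exact: face_trans pw.
Qed.

Lemma regular_neq0 v a : regular ip Phi v -> Phi a -> ip a v != 0.
Proof. by move=> rv Pa; apply/eqP => av; apply: rv; exists a. Qed.

Lemma cell_regular v w : regular ip Phi v -> cell v w -> regular ip Phi w.
Proof.
move=> rv vw [a Pa /= aw]; have /eqP := regular_neq0 rv Pa.
by case: (vw a Pa) => -[]; rewrite aw ?ltxx.
Qed.

Lemma regular_faceP p w : regular ip Phi w ->
  (forall a, Phi a -> 0 < ip a w -> 0 <= ip a p) -> face p w.
Proof.
by move=> rw h a Pa; rewrite le_eqVlt eq_sym (negbTE (regular_neq0 rw Pa)); exact: h.
Qed.

Lemma regular_face_sym v w : regular ip Phi v -> regular ip Phi w ->
  face v w -> face w v.
Proof.
move=> rv rw vw; apply: regular_faceP => // a Pa av; rewrite leNgt; apply/negP => aw.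
have := vw _ (PhiN Pa); rewrite !ipNl !oppr_ge0 => /(_ (ltW aw)).
by rewrite leNgt av.
Qed.

(** A connected set of regular vectors cannot cross a root hyperplane, because
the positive side is both open and closed in it; conversely a facet contains the
segment between any two of its points. *)
Lemma regular_component v : regular ip Phi v ->
  connected_component (regular ip Phi : set (euclidean ip)) v = cell v.
Proof.
move=> rv; apply/seteqP; split=> w.
  move=> [B [Bv Breg cB]] Bw a Pa.
  have key b : Phi b -> 0 < ip b v -> 0 < ip b w.
    move=> Pb bv; have : B `&` [set y | 0 < ip b y] = B; last first.
      by move=> BE; have : B w by []; rewrite -BE => -[].
    apply: cB; first by exists v.
      by exists [set y | 0 < ip b y] => //; exact: (open_halfspace (ip := ip)).
    exists [set y | ip (- b) y <= 0]; first exact: (closed_halfspace (ip := ip)).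
    apply/seteqP; split=> y [By] /=; rewrite ipNl oppr_le0; first by move/ltW.
    by rewrite le_eqVlt eq_sym (negbTE (regular_neq0 (Breg _ By) Pb)).
  have /lt_total/orP[] := regular_neq0 rv Pa => av.
    have := key _ (PhiN Pa); rewrite !ipNl !oppr_gt0 => /(_ av) aw.
    by constructor 3.
  by constructor 2; split => //; exact: key.
move=> vw; pose f := ((fun t : R => v + t *: (w - v)) : R -> euclidean ip).
exists (f @` `[0, 1]%classic); last first.
  exists 1; first by rewrite /= in_itv /= ler01 lexx.
  by rewrite /f scale1r addrC subrK.
split.
- by exists 0; rewrite /= ?in_itv /= ?ler01 ?lexx // /f scale0r addr0.
- move=> _ [t /= + <-]; rewrite in_itv /= => /andP[t0 t1] [a Pa /=].
  rewrite /f ipDr ipZr ipDr ipNr => h.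
  have /eqP := regular_neq0 rv Pa; case: (vw a Pa) => -[] // x y _; nra.
- apply: connected_continuous_connected; first exact: segment_connected.
  by apply: continuous_subspaceT => t; exact: (continuous_line (ip := ip)).
Qed.

Lemma chambersP C : chambers ip Phi C <-> exists2 v, regular ip Phi v & C = cell v.
Proof. by split=> -[v rv ->]; exists v; rewrite ?regular_component. Qed.

(** Adding [u] to a large multiple of [q] does not disturb the strict
inequalities that hold at [q]. This is the form in which the small perturbations
[q + e u] of the geometric arguments appear. *)
Lemma perturb (s : seq V) q u :
  exists T : R, {in s, forall a, 0 < ip a q -> 0 < ip a (T *: q + u)}.
Proof.
elim: s => [|a s [T IH]]; first by exists 0.
pose T' := (`|ip a u| + 1) / ip a q; exists (Num.max T T').
move=> b; rewrite inE => /orP[/eqP->|bs] bq; rewrite ipDr ipZr.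
  have h : T' * ip a q <= Num.max T T' * ip a q by rewrite ler_pM2r // le_max lexx orbT.
  rewrite /T' divfK ?gt_eqF // in h; apply: (lt_le_trans _ (lerD h (lexx _))).
  have := ler_norm (- ip a u); rewrite normrN; lra.
have := IH b bs bq; rewrite ipDr ipZr => h; apply: (lt_le_trans h).
by rewrite lerD2r ler_pM2r // le_max lexx.
Qed.

End Facets.

(** Measures the two inductions below: on the height of a root above the walls of
a chamber, and on the number of hyperplanes between two chambers. *)
Lemma ltn_count (T : eqType) (P Q : pred T) (s : seq T) x :
  {in s, forall y, P y -> Q y} -> x \in s -> Q x -> ~~ P x ->
  (count P s < count Q s)%N.
Proof.
move=> PQ xs Qx /negbTE Px; have /permP E := perm_to_rem xs.
rewrite !E /= Qx Px add0n ltnS -[X in (X <= _)%N]size_filter.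
have -> : [seq y <- rem x s | P y] = [seq y <- [seq y <- rem x s | Q y] | P y].
  rewrite -filter_predI; apply: eq_in_filter => y /mem_rem ys /=.
  by case: (P y) (PQ y ys) => //= ->.
by rewrite size_filter -[X in (_ <= X)%N]size_filter count_size.
Qed.

(** * Simple roots and fundamental weights *)

Section SimpleRoots.
Context {R : realType} {V : vectType R} (ip : {dot V for idfun}).
Implicit Types (a b p q u v w : V).

(** In a linear relation, collect the terms with positive coefficients into [w].
The remaining terms sum to [- w], so [ip w w <= 0] by obtuseness and [w = 0];
pairing with [v] then shows that no coefficient was positive. *)
Lemma obtuse_free (s : seq V) v : uniq s -> {in s, forall b, 0 < ip b v} ->
  {in s &, forall a b, a != b -> ip a b <= 0} -> free s.
Proof.
move=> us sv obt; rewrite -[s]/(tval (in_tuple s)); apply/freeP.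
have key (k : 'I_(size s) -> R) : \sum_i k i *: s`_i = 0 -> forall i, k i <= 0.
  move=> k0 i; rewrite leNgt; apply/negP => ki.
  pose w := \sum_(i | 0 < k i) k i *: s`_i.
  have w0 : w = 0.
    apply: (ip_eq0 (ip := ip)); apply/eqP; rewrite eq_le ip_ge0 andbT.
    have wE : w = - \sum_(i | ~~ (0 < k i)) k i *: s`_i.
      by move: k0; rewrite (bigID (fun i => 0 < k i)) /= => /eqP; rewrite addr_eq0 => /eqP.
    rewrite {2}wE ipNr oppr_le0 ip_suml sumr_ge0 // => j kj.
    rewrite ip_sumr sumr_ge0 // => l; rewrite -leNgt => kl.
    rewrite ipZl ipZr mulrA mulr_le0 // ?mulr_ge0_le0 // ?(ltW kj) //.
    apply: obt; rewrite ?mem_nth // nth_uniq //; apply: contraTneq kj => jl.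
    by rewrite (val_inj jl) -leNgt.
  have := ip0l ip v; rewrite -w0 ip_suml (bigD1 i) //= => /eqP; rewrite gt_eqF //.
  rewrite ltr_wpDr ?ipZl ?mulr_gt0 ?sv ?mem_nth // sumr_ge0 // => j /andP[kj _].
  by rewrite ipZl ltW // mulr_gt0 ?sv ?mem_nth.
move=> k k0 i; apply/eqP; rewrite eq_le key //= -oppr_le0.
apply: (key (fun i => - k i)); under eq_bigr do rewrite scaleNr.
by rewrite sumrN k0 oppr0.
Qed.

Lemma dual_basis (s : seq V) : basis_of fullv s -> exists l : V -> V,
  [/\ {in s &, forall a b, ip a (l b) = (a == b)%:R},
      forall v, v = \sum_(b <- s) ip v (l b) *: b &
      forall v, v = \sum_(b <- s) ip b v *: l b].
Proof.
move=> bs; have fs : free s by case/andP: bs.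
have us := free_uniq fs.
pose r (i : 'I_(size s)) := sharp ip (linfun (coord (in_tuple s) i : V -> R^o)).
have rE i v : ip v (r i) = coord (in_tuple s) i v by rewrite ipC sharpE lfunE.
pose l b := if insub (index b s) is Some i then r i else 0.
have lE (i : 'I_(size s)) : l s`_i = r i by rewrite /l index_uniq // valK.
have h1 : {in s &, forall a b, ip a (l b) = (a == b)%:R}.
  move=> a b /(nthP 0)[i il <-] /(nthP 0)[j jl <-].
  rewrite nth_uniq // (lE (Ordinal jl)) rE.
  by rewrite (coord_free (X := in_tuple s) (Ordinal il) (Ordinal jl)).
have h2 v : v = \sum_(b <- s) ip v (l b) *: b.
  rewrite {1}(coord_basis (X := in_tuple s) bs (memvf v)) [RHS](big_nth 0) big_mkord.
  by apply: eq_bigr => i _; rewrite lE rE.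
exists l; split=> // v; apply/eqP; rewrite -subr_eq0; apply/eqP.
set x := v - _; have xb b : b \in s -> ip b x = 0.
  move=> bs'; rewrite ipDr ipNr ip_sumr (bigD1_seq b) //= ipZr h1 // eqxx mulr1.
  rewrite big_seq_cond big1 ?addr0 ?subrr // => a /andP[a_s ab].
  by rewrite ipZr h1 // eq_sym (negbTE ab) mulr0.
apply: (ip_eq0 (ip := ip)); rewrite {1}(h2 x) ip_suml big_seq big1 // => b bs'.
by rewrite ipZl xb // mulr0.
Qed.

End SimpleRoots.

Section RootSystems.
Context {R : realType} {V : vectType R} (ip : {dot V for idfun}) (Phi : set V).
Implicit Types (a b p q u v w : V).
Hypothesis RS : root_system ip Phi.

Lemma root_seq : exists2 s : seq V, uniq s & forall a, Phi a <-> a \in s.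
Proof.
have /finite_seqP[s PhiE] := root_finite RS.
by exists (undup s); [exact: undup_uniq | move=> a; rewrite mem_undup PhiE].
Qed.

Lemma root_nonzero a : Phi a -> a != 0.
Proof. by move=> Pa; apply/eqP => a0; apply: (root_neq0 RS); rewrite -a0. Qed.

Lemma root_opp a : Phi a -> Phi (- a).
Proof.
move=> Pa; rewrite -(reflection_self ip (root_nonzero Pa)).
exact: (root_reflection RS).
Qed.

(** If [u] avoids the earlier hyperplanes but lies on that of [a], then so does
[T *: u + a] for large [T], and its pairing with [a] is [ip a a]. *)
Lemma avoid_hyperplanes (s : seq V) : 0 \notin s ->
  exists u, {in s, forall a, ip a u != 0}.
Proof.
elim: s => [|a s IH]; first by exists 0.
rewrite inE negb_or => /andP[a0 /IH[u us]].
have [T h] := perturb ip (s ++ [seq - b | b <- s]) u a.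
have [au|au] := eqVneq (ip a u) 0; last first.
  by exists u => b; rewrite inE => /orP[/eqP->|/us].
exists (T *: u + a) => b; rewrite inE => /orP[/eqP->|bs].
  by rewrite ipDr ipZr au mulr0 add0r gt_eqF // ip_gt0 // eq_sym.
have /lt_total/orP[bu|bu] := us b bs.
  rewrite lt_eqF //; have := h (- b); rewrite !ipNl !oppr_gt0; apply=> //.
  by rewrite mem_cat map_f ?orbT.
by rewrite gt_eqF // h // mem_cat bs.
Qed.

Lemma regular_exists : exists u, regular ip Phi u.
Proof.
have [s _ sP] := root_seq; have [|u us] := avoid_hyperplanes (s := s).
  by apply/negP => /sP /root_nonzero; rewrite eqxx.
by exists u => -[a /sP/us + /= au]; rewrite au eqxx.
Qed.

(** The vector [T *: q + u] plays the part of [q + e u] for small [e]: it is in a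
chamber whose closure contains [q], as soon as [u] avoids the hyperplanes through
[q]. *)
Lemma regular_near q u : (forall a, Phi a -> ip a q = 0 -> ip a u != 0) ->
  exists2 T : R, regular ip Phi (T *: q + u) & face ip Phi q (T *: q + u).
Proof.
move=> ru; have [s _ sP] := root_seq; have [T h] := perturb ip s q u.
have hN a : Phi a -> ip a q < 0 -> ip a (T *: q + u) < 0.
  by move=> /root_opp /sP /h; rewrite !ipNl !oppr_gt0.
exists T.
  move=> [a Pa /= aw]; have := hN _ Pa; have := h _ (proj1 (sP a) Pa); rewrite aw ltxx.
  case: (ltgtP (ip a q) 0) => [_ _ /(_ isT)|_ /(_ isT)|aq _ _] //.
  move: aw; rewrite ipDr ipZr aq mulr0 add0r; apply/eqP; exact: ru.
move=> a Pa; rewrite !leNgt; apply: contra; exact: hN.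
Qed.

Lemma regular_face q : exists2 v, regular ip Phi v & face ip Phi q v.
Proof.
have [u ru] := regular_exists.
have [|T rv qv] := @regular_near q u; last by exists (T *: q + u).
by move=> a Pa _; exact: regular_neq0 ru Pa.
Qed.

(** The two Cartan integers of [a] and [b] are positive and, by the strict
Cauchy-Schwarz inequality, their product is less than [4]; so one of them is [1],
and the corresponding reflection produces [a - b] or its opposite. *)
Lemma root_sub a b : Phi a -> Phi b -> a != b -> 0 < ip a b -> Phi (a - b).
Proof.
move=> Pa Pb ab abp.
have aa := ip_gt0 ip (root_nonzero Pa); have bb := ip_gt0 ip (root_nonzero Pb).
have CSs : ip a b ^+ 2 < ip a a * ip b b.
  have : ip b b *: a - ip a b *: b != 0.
    apply: contra_not_neq (elimN eqP ab) => /eqP; rewrite subr_eq0 => /eqP h.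
    have aE : a = (ip a b / ip b b) *: b.
      by rewrite mulrC -scalerA -h scalerA mulVf ?scale1r ?gt_eqF.
    have := Pa; rewrite aE => /(root_reduced RS Pb)[-> | k]; first by rewrite scale1r.
    have : 0 < ip a b / ip b b by rewrite divr_gt0.
    by rewrite k ltr0N1.
  move=> /(ip_gt0 ip); rewrite ipDl !ipDr !ipNl !ipNr !ipZl !ipZr (ipC ip b a).
  by move=> h; rewrite -subr_gt0 -(pmulr_rgt0 _ bb); move: h; congr (_ < _); ring.
have /intrP[m mE] := root_crystallographic RS Pa Pb.
have /intrP[n nE] := root_crystallographic RS Pb Pa.
have m0 : 0 < m by rewrite -(ltr0z R) -mE divr_gt0 // mulr_gt0.
have n0 : 0 < n by rewrite -(ltr0z R) -nE divr_gt0 // mulr_gt0 // ipC.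
have mn : m * n < 4.
  rewrite -(ltr_int R) intrM -mE -nE (ipC ip b a) mulf_div.
  rewrite ltr_pdivrMr ?mulr_gt0 //; nra.
have [m1|n1] : m = 1 \/ n = 1 by nia.
- rewrite -opprB; apply: root_opp; have := root_reflection RS Pa Pb.
  by rewrite reflectionE mE m1 scale1r.
- have := root_reflection RS Pb Pa.
  by rewrite reflectionE nE n1 scale1r.
Qed.

(** The simple roots are the positive roots that are not sums of two positive
roots. Decomposing a positive root lowers its pairing with [v], so the process
stops and every positive root is a sum of simple ones. Distinct simple roots are
at obtuse angles by [root_sub], hence independent by [obtuse_free]. *)
Lemma simple_roots_exist v : regular ip Phi v -> exists2 s : seq V,
  simple_roots Phi s & {in s, forall b, 0 < ip b v}.
Proof.
move=> rv; have [rs urs rsP] := root_seq.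
(* [dec a b]: [a] is the sum of the positive roots [b] and [a - b]. *)
pose dec a b := [&& b \in rs, 0 < ip b v, (a - b) \in rs & 0 < ip (a - b) v].
pose s := [seq a <- rs | (0 < ip a v) && ~~ has (dec a) rs].
have us : uniq s by exact: filter_uniq.
have sv b : b \in s -> 0 < ip b v by rewrite mem_filter => /andP[/andP[]].
have sPhi b : b \in s -> Phi b by rewrite mem_filter => /andP[_] /rsP.
have sdec a b : a \in s -> ~ dec a b.
  rewrite mem_filter => /andP[/andP[_ /hasPn h] _] /[dup] /andP[/h/negP]; exact.
have comb a : Phi a -> 0 < ip a v -> exists k : V -> nat, a = \sum_(b <- s) b *+ k b.
  have [n] := ubnP (count (fun c => ip c v < ip a v) [seq c <- rs | 0 < ip c v]).
  elim: n a => // n IH a; rewrite ltnS => an Pa av.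
  have [/hasP[b _ /and4P[/rsP Pb bv /rsP Pc cv]]|ndec] := boolP (has (dec a) rs).
    have lt_a x y : Phi x -> 0 < ip x v -> 0 < ip y v -> a = x + y ->
        exists k : V -> nat, x = \sum_(b <- s) b *+ k b.
      move=> Px xv yv axy; have xa : ip x v < ip a v by rewrite axy ipDl ltrDl.
      apply: IH => //; apply: leq_trans an; apply: (ltn_count (x := x)) => //=.
      - by move=> z _ /lt_trans; apply.
      - by rewrite mem_filter xv; apply/rsP.
      - by rewrite ltxx.
    have [k1 E1] := lt_a b (a - b) Pb bv cv (esym (subrKC _ _)).
    have [k2 E2] := lt_a (a - b) b Pc cv bv (esym (subrK _ _)).
    exists (fun c => (k1 c + k2 c)%N); under eq_bigr do rewrite mulrnDr.
    by rewrite big_split /= -E1 -E2 subrKC.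
  have a_s : a \in s by rewrite mem_filter av ndec; apply/rsP.
  exists (fun c => (c == a) : nat); rewrite (bigD1_seq a) //= eqxx mulr1n.
  by rewrite big1 ?addr0 // => i /negbTE ->.
have cmb a : Phi a -> exists k : V -> nat,
    a = \sum_(b <- s) b *+ k b \/ a = - \sum_(b <- s) b *+ k b.
  move=> Pa; have /lt_total/orP[av|av] := regular_neq0 rv Pa.
    have [|k kE] := comb _ (root_opp Pa); first by rewrite ipNl oppr_gt0.
    by exists k; right; rewrite -kE opprK.
  by have [k ->] := comb _ Pa av; exists k; left.
exists s => //; split=> //; rewrite /basis_of; apply/andP; split; last first.
  apply: (obtuse_free us sv) => a b a_s b_s ab; rewrite leNgt; apply/negP => abp.
  have Pab := root_sub (sPhi _ a_s) (sPhi _ b_s) ab abp.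
  have /lt_total/orP[av|av] := regular_neq0 rv Pab.
    apply: (sdec b a b_s); rewrite /dec sv // (proj1 (rsP _) (sPhi _ a_s)) -opprB.
    by rewrite (proj1 (rsP _) (root_opp Pab)) ipNl oppr_gt0.
  apply: (sdec a b a_s); rewrite /dec sv // (proj1 (rsP _) (sPhi _ b_s)).
  by rewrite (proj1 (rsP _) Pab).
rewrite eqEsubv subvf; apply/subvP => x _; have [t tPhi] := root_span RS x.
apply: subvP; apply/span_subvP => a /tPhi /cmb[k kE].
have sk : \sum_(b <- s) b *+ k b \in <<s>>%VS.
  by rewrite big_seq; apply: rpred_sum => b bs; rewrite rpredMn ?memv_span.
by case: kE => ->; rewrite ?rpredN.
Qed.

End RootSystems.

(** * The geometry of a chamber *)

Section Chamber.
Context {R : realType} {V : vectType R} (ip : {dot V for idfun}) (Phi : set V).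
Implicit Types (a b p q u v w x y : V).
Hypothesis RS : root_system ip Phi.

Lemma faceN x y : face ip Phi x y -> face ip Phi (- x) (- y).
Proof. by move=> xy a /(root_opp RS) /xy; rewrite !ipNl !ipNr. Qed.

Lemma facet_opp_cell p : facet_opp (cell ip Phi p) = cell ip Phi (- p).
Proof.
have PN := root_opp RS; apply/seteqP; split=> [_ [w /(same_facetP ip PN)[h1 h2] <-]|w].
  by apply/(same_facetP ip PN); split; exact: faceN.
move=> /(same_facetP ip PN)[/faceN h1 /faceN h2]; rewrite opprK in h1 h2.
by exists (- w); rewrite ?opprK //; apply/(same_facetP ip PN).
Qed.

Lemma reflection_fixed a p : ip a p = 0 -> reflection ip a p = p.
Proof. by move=> h; rewrite /reflection h mulr0 mul0r scale0r subr0. Qed.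

Lemma regular_reflection a v : Phi a -> regular ip Phi v ->
  regular ip Phi (reflection ip a v).
Proof.
move=> Pa rv [b Pb /=]; rewrite -ip_reflection ?(root_nonzero RS) // => h.
by apply: rv; exists (reflection ip a b) => //; exact: (root_reflection RS).
Qed.

Lemma reflection_cell a v : Phi a ->
  cell ip Phi (reflection ip a v) = reflection ip a @` cell ip Phi v.
Proof.
move=> Pa; have a0 := root_nonzero RS Pa; have PN := root_opp RS.
have aP b : Phi b -> Phi (reflection ip a b) by exact: (root_reflection RS).
apply/seteqP; split=> [w /(same_facetP ip PN)[h1 h2]|_ [w /(same_facetP ip PN)[h1 h2] <-]].
  exists (reflection ip a w); last exact: reflectionK.
  have := face_reflection a0 aP h1; have := face_reflection a0 aP h2.
  by rewrite reflectionK // => g2 g1; apply/(same_facetP ip PN).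
by apply/(same_facetP ip PN); split;
  [exact: (face_reflection a0 aP h1) | exact: (face_reflection a0 aP h2)].
Qed.

Section Basis.
Variables (v : V) (s : seq V) (l : V -> V).
Hypothesis rv : regular ip Phi v.
Hypothesis ss : simple_roots Phi s.
Hypothesis sv : {in s, forall b, 0 < ip b v}.
Hypothesis ls : {in s &, forall a b, ip a (l b) = (a == b)%:R}.
Hypothesis lE : forall x, x = \sum_(b <- s) ip x (l b) *: b.

Let s_uniq : uniq s. Proof. by case: ss => _ /andP[_ /free_uniq]. Qed.
Let s_root b : b \in s -> Phi b. Proof. by case: ss => + _ _; apply. Qed.

(** The basis [l] dual to [s] consists of the fundamental weights of the chamber
of [v]; the pairing with [l b] reads off the coefficient of the simple root [b]. *)
Lemma root_coef_ge0 a b : Phi a -> 0 < ip a v -> b \in s -> 0 <= ip a (l b).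
Proof.
move=> Pa av bs; have coef (k : V -> nat) : ip (\sum_(c <- s) c *+ k c) (l b) = (k b)%:R.
  rewrite ip_suml (bigD1_seq b) //= -scaler_nat ipZl ls // eqxx mulr1.
  rewrite big_seq_cond big1 ?addr0 // => c /andP[cs cb].
  by rewrite -scaler_nat ipZl ls // (negbTE cb) mulr0.
case: ss => _ _ /(_ a Pa)[k [aE|aE]]; first by rewrite aE coef.
suff : ip a v <= 0 by rewrite leNgt av.
rewrite aE ipNl oppr_le0 ip_suml big_seq sumr_ge0 // => c cs.
by rewrite -scaler_nat ipZl mulr_ge0 // ltW // sv.
Qed.

Lemma weight_face b : b \in s -> face ip Phi (l b) v.
Proof.
by move=> bs; apply: regular_faceP => // a Pa av; exact: root_coef_ge0.
Qed.

Lemma weight_vert b w : b \in s -> face ip Phi (l b) w -> vert ip Phi (cell ip Phi w) (l b).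
Proof.
move=> bs bw; split; last exact/(cl_cell ip (root_opp RS)).
exists s, b; split=> //; first by rewrite ls // eqxx.
by move=> c cs cb; rewrite ls // (negbTE cb).
Qed.

(** The reflection in the simple root [a] changes only the coefficient of [a], and
a positive root other than [a] has another positive coefficient, because the
root system is reduced. *)
Lemma simple_reflection_pos a g : a \in s -> Phi g -> 0 < ip g v -> g != a ->
  0 < ip (reflection ip a g) v.
Proof.
move=> a_s Pg gv ga; have Pa := s_root a_s.
have [b bs /andP[ba gb]] : exists2 b, b \in s & (b != a) && (0 < ip g (l b)).
  apply/hasP; apply: contraT => /hasPn h.
  have gE : g = ip g (l a) *: a.
    rewrite {1}(lE g) (bigD1_seq a) //= big_seq_cond big1 ?addr0 // => c /andP[cs ca].
    have := h _ cs; rewrite ca /= -leNgt => gc; have := root_coef_ge0 Pg gv cs.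
    by move=> gc'; rewrite (_ : ip g (l c) = 0) ?scale0r //; apply/eqP; rewrite eq_le gc.
  have := Pg; rewrite gE => /(root_reduced RS Pa)[k1|k1].
    by rewrite gE k1 scale1r eqxx in ga.
  by have := gv; rewrite gE k1 scaleN1r ipNl oppr_gt0 ltNge ltW // sv.
set k := reflection _ _ _; have Pk : Phi k by exact: (root_reflection RS).
have kb : ip k (l b) = ip g (l b).
  by rewrite /k reflectionE ipDl ipNl ipZl (ls a_s bs) eq_sym (negbTE ba) mulr0 subr0.
have /lt_total/orP[kv|//] := regular_neq0 rv Pk.
have : 0 <= ip (- k) (l b) by apply: root_coef_ge0 (root_opp RS Pk) _ bs; rewrite ipNl oppr_gt0.
by rewrite ipNl kb oppr_ge0 leNgt gb.
Qed.

End Basis.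

Lemma chamber_basis v : regular ip Phi v -> exists s (l : V -> V),
  [/\ simple_roots Phi s, {in s, forall b, 0 < ip b v},
      {in s &, forall a b, ip a (l b) = (a == b)%:R},
      forall x, x = \sum_(b <- s) ip x (l b) *: b &
      forall x, x = \sum_(b <- s) ip b x *: l b].
Proof.
move=> rv; have [s ss sv] := simple_roots_exist RS rv.
have [_ bs _] := ss; have [l [h1 h2 h3]] := dual_basis ip bs.
by exists s, l.
Qed.

(** In the simplicial cone spanned by the weights [l b], the closure of the facet
of [p] is the face spanned by the weights that occur in [p]. For a root [g] that
is negative on [v] and nonnegative on [p], the expansion of [ip g p] has only
nonpositive terms, so each of them is zero. *)
Lemma weight_face_facet p v s (l : V -> V) b : regular ip Phi v -> face ip Phi p v ->
  simple_roots Phi s -> {in s, forall b, 0 < ip b v} ->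
  {in s &, forall a b, ip a (l b) = (a == b)%:R} ->
  (forall x, x = \sum_(b <- s) ip b x *: l b) ->
  b \in s -> ip b p != 0 -> 0 < ip b p /\ face ip Phi (l b) p.
Proof.
move=> rv pv ss sv ls sE bs bp0; have [sP /andP[_ /free_uniq us] _] := ss.
have PN := root_opp RS.
have pos c : c \in s -> 0 <= ip c p by move=> cs; exact: pv (sP _ cs) (ltW (sv c cs)).
have bp : 0 < ip b p by rewrite lt0r bp0 pos.
split=> // g Pg gp.
have /lt_total/orP[gv|gv] := regular_neq0 rv Pg; last exact: (root_coef_ge0 ss sv ls).
have neg c : c \in s -> ip g (l c) <= 0.
  move=> cs; rewrite -oppr_ge0 -ipNl.
  by apply: (root_coef_ge0 ss sv ls (PN _ Pg)); rewrite // ipNl oppr_gt0.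
have : ip g p <= ip b p * ip g (l b).
  rewrite {1}(sE p) ip_sumr (bigD1_seq b) //= ipZr gerDl big_seq_cond.
  rewrite sumr_le0 // => c /andP[cs _]; rewrite ipZr mulr_ge0_le0 ?neg ?pos //.
by move/(le_trans gp); rewrite pmulr_rge0.
Qed.

(** The weights in the closure of a facet span it, so they may be replaced by any
point of the facet in the definition of [facet_roots]. *)
Lemma facet_rootsE p : facet_roots ip Phi (cell ip Phi p) = [set a | Phi a /\ 0 <= ip a p].
Proof.
have PN := root_opp RS; apply/seteqP; split=> a [Pa ap]; split=> //; last first.
  by move=> x [_ /(cl_cell ip PN)]; apply.
have [v rv pv] := regular_face RS p.
have [s [l [ss sv ls lE sE]]] := chamber_basis rv.
rewrite (sE p) ip_sumr big_seq sumr_ge0 // => b bs; rewrite ipZr.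
have [->|bp] := eqVneq (ip b p) 0; first by rewrite mul0r.
have [bp' lp] := weight_face_facet rv pv ss sv ls sE bs bp.
rewrite mulr_ge0 ?(ltW bp') //; exact/ap/(weight_vert ss ls bs lp).
Qed.

End Chamber.

(** * The sum of the roots that are nonnegative on a facet *)

Section Sigma.
Context {R : realType} {V : vectType R} (ip : {dot V for idfun}) (Phi : set V).
Implicit Types (a b p q u v w x y : V).
Hypothesis RS : root_system ip Phi.

(** For a chamber this is twice the half-sum of positive roots; roots orthogonal
to the facet cancel in pairs. *)
Definition facet_sum p : V := \sum_(a \in facet_roots ip Phi (cell ip Phi p)) a.

Lemma sum_facet_roots (W : nmodType) (f : V -> W) (s : seq V) p :
  uniq s -> (forall a, Phi a <-> a \in s) ->
  \sum_(a \in facet_roots ip Phi (cell ip Phi p)) f a =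
  \sum_(a <- s | 0 <= ip a p) f a.
Proof.
move=> us sP; rewrite -[RHS]big_filter [RHS]fsbig_seq ?filter_uniq // facet_rootsE //.
apply: eq_fsbigl.
apply/seteqP; split=> a /=; rewrite mem_filter; first by move=> [/sP -> ->].
by move=> /andP[-> /sP].
Qed.

(** Pair each root [a] with its reflection in [g], on which the pairing with [g]
changes sign. A root contributes to the doubled sum only if exactly one of [a]
and its reflection is nonnegative on [p], and then its contribution is positive
when [ip g p] is; [g] itself contributes [ip g g]. When [ip g p = 0] the
reflection preserves the sign on [p] and everything cancels. *)
Lemma facet_sum_pairing p g : Phi g ->
  (ip g p = 0 -> ip g (facet_sum p) = 0) /\ (0 < ip g p -> 0 < ip g (facet_sum p)).
Proof.
move=> Pg; have g0 := root_nonzero RS Pg; have [s us sP] := root_seq RS.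
rewrite /facet_sum (sum_facet_roots _ _ us sP) ip_sumr big_mkcond /=.
pose r := reflection ip g.
pose F a := if 0 <= ip a p then ip g a else 0.
have gr a : ip g (r a) = - ip g a.
  by rewrite -ip_reflection // reflection_self // ipNl.
have rp a : ip (r a) p = ip a p - 2 * ip g a / ip g g * ip g p.
  by rewrite /r reflectionE ipDl ipNl ipZl.
have FE : (\sum_(a <- s) F a) *+ 2 = \sum_(a <- s) (F a + F (r a)).
  rewrite mulr2n big_split /=; congr (_ + _).
  rewrite -(big_map r xpredT F); apply: perm_big; rewrite perm_sym; apply: uniq_perm => //.
    by rewrite map_inj_uniq //; apply: inv_inj; exact: reflectionK.
  move=> a; apply/mapP/idP => [[b /sP Pb ->]|/sP Pa].
    by apply/sP; exact: (root_reflection RS).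
  exists (r a); last by rewrite /r reflectionK.
  by apply/sP; exact: (root_reflection RS).
split=> gp.
  suff /eqP : (\sum_(a <- s) F a) *+ 2 = 0 by rewrite mulrn_eq0 => /eqP.
  by rewrite FE big1 // => a _; rewrite /F rp gp mulr0 subr0 gr; case: ifP; rewrite ?subrr ?addr0.
suff : 0 < (\sum_(a <- s) F a) *+ 2 by rewrite pmulrn_lgt0.
have gg := ip_gt0 ip g0.
have pos a : 0 <= F a + F (r a).
  rewrite /F rp gr; set t := 2 * _ / _ * _.
  have t_gt0 : (0 < t) = (0 < ip g a) by rewrite /t pmulr_lgt0 // pmulr_lgt0 ?invr_gt0 // pmulr_rgt0.
  have t_lt0 : (t < 0) = (ip g a < 0) by rewrite /t pmulr_llt0 // pmulr_llt0 ?invr_gt0 // pmulr_rlt0.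
  have [h1|h1] := leP 0 (ip a p); have [h2|h2] := leP 0 (ip a p - t).
  - by rewrite subrr.
  - by rewrite addr0 ltW // -t_gt0; lra.
  - by rewrite add0r oppr_ge0 ltW // -t_lt0; lra.
  - by rewrite addr0.
rewrite FE (bigD1_seq g) //=; last by apply/sP.
rewrite ltr_wpDr ?sumr_ge0 // /F rp gr (ltW gp) mulfK ?gt_eqF //.
rewrite (_ : 0 <= _ = false) ?addr0 //; apply/negbTE; rewrite -ltNge; lra.
Qed.

Lemma facet_sum_facet p :
  face ip Phi (facet_sum p) p /\ face ip Phi p (facet_sum p).
Proof.
have PN := root_opp RS; split=> a Pa; have [h1 h2] := facet_sum_pairing p Pa.
  by rewrite le_eqVlt => /orP[/eqP/esym/h1->|/h2/ltW].
have [_] := facet_sum_pairing p (PN _ Pa); rewrite !ipNl !oppr_gt0 => h.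
by rewrite !leNgt; apply: contra.
Qed.

End Sigma.

Lemma conjugate_cells {R : realType} {V : vectType R} (ip : {dot V for idfun})
    (Phi : set V) a v : root_system ip Phi -> Phi a -> 0 < ip a v ->
  conjugate_chambers ip a (cell ip Phi v) (cell ip Phi (reflection ip a v)).
Proof.
move=> RS Pa av; split; last exact: reflection_cell.
  by move=> w /(_ a Pa); case=> [[h]|[]|[h]] //; move: av; rewrite ?h ?ltxx // ltNge ltW.
have a0 := root_nonzero RS Pa.
have {}av : ip a (reflection ip a v) < 0.
  by rewrite -ip_reflection // reflection_self // ipNl oppr_lt0.
by move=> w /(_ a Pa); case=> [[h]|[h]|[]] //; move: av; rewrite ?h ?ltxx // ltNge ltW.
Qed.

(** * Vertices of a complementary polyhedron *)

Section Polyhedron.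
Context {R : realType} {V : vectType R} (ip : {dot V for idfun}) (Phi : set V).
Variable d : set V -> 'Hom(V, R^o).
Implicit Types (a b p q u v w x y : V).
Hypothesis RS : root_system ip Phi.
Hypothesis CP : complementary_polyhedron ip Phi d.
Local Notation D v x := (d (cell ip Phi v) x : R).

(** The weights [l b] with [b != a] are fixed by the reflection, so they belong to
both chambers and (A1) makes the difference of the two functionals vanish on
them; (A2) determines the sign of what is left. *)
Lemma wall_crossing v a s (l : V -> V) : regular ip Phi v ->
  simple_roots Phi s -> {in s, forall b, 0 < ip b v} ->
  {in s &, forall a b, ip a (l b) = (a == b)%:R} ->
  (forall x, x = \sum_(b <- s) ip b x *: l b) -> a \in s ->
  exists2 c : R, 0 <= c & forall x, D (reflection ip a v) x = D v x + c * ip a x.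
Proof.
move=> rv ss sv ls sE a_s; have [sP /andP[_ /free_uniq us] _] := ss.
have PN := root_opp RS; have Pa := sP _ a_s; have a0 := root_nonzero RS Pa.
have [A1 A2] := CP; set v' := reflection _ _ _.
have rv' : regular ip Phi v' by exact: regular_reflection.
have cv : chambers ip Phi (cell ip Phi v) by apply/(chambersP ip PN); exists v.
have cv' : chambers ip Phi (cell ip Phi v') by apply/(chambersP ip PN); exists v'.
have lf b : b \in s -> face ip Phi (l b) v by move=> bs; exact: (weight_face rv ss sv ls bs).
pose f := d (cell ip Phi v') - d (cell ip Phi v).
have fE x : (f x : R) = D v' x - D v x by rewrite add_lfunE opp_lfunE.
have f0 b : b \in s -> b != a -> f (l b) = 0.
  move=> bs ba; rewrite fE; apply/eqP; rewrite subr_eq0; apply/eqP/A1 => //.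
    apply: (weight_vert RS ss ls bs).
    have := face_reflection a0 _ (lf b bs); rewrite reflection_fixed //; last first.
      by rewrite ls // eq_sym (negbTE ba).
    by apply=> c Pc; exact: (root_reflection RS).
  exact: (weight_vert RS ss ls bs (lf b bs)).
have fx x : (f x : R) = f (l a) * ip a x.
  rewrite {1}(sE x) linear_sum (bigD1_seq a) //= big_seq_cond big1 => [|b /andP[bs ba]].
    by rewrite addr0 linearZ /= mulrC.
  by rewrite linearZ /= f0 // scaler0.
exists (f (l a)); last by move=> x; rewrite -fx fE addrC subrK.
have : 0 <= (f a : R).
  by rewrite fE subr_ge0; apply: A2 => //; apply: (conjugate_cells RS) => //; exact: sv.
by rewrite fx pmulr_lge0 // ip_gt0.
Qed.

(** Induction on the number of roots that are positive on [v] and negative on [w].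
If there are any, a simple root [a] of the chamber of [v] is among them, and
reflecting in [a] removes it from their list and adds a nonnegative multiple of
[ip a x] to the value at [x]. *)
Lemma polyhedron_min v w x : regular ip Phi v -> regular ip Phi w ->
  face ip Phi x v -> D v x <= D w x.
Proof.
move=> rv rw xv.
(* The hypothesis on [x] has to survive the passage to the reflected chamber, so
it is weakened to the roots that separate [v] from [w]. *)
suff key : forall v, regular ip Phi v ->
    (forall a, Phi a -> 0 < ip a v -> ip a w < 0 -> 0 <= ip a x) -> D v x <= D w x.
  by apply: key => // a Pa /ltW av _; exact: xv.
have [rs urs rsP] := root_seq RS; have PN := root_opp RS.
move=> {rv xv}v.
have [n] := ubnP (count (fun a => (0 < ip a v) && (ip a w < 0)) rs).
elim: n v => // n IH v; rewrite ltnS => cn rv hx.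
have [s [l [ss sv ls lE sE]]] := chamber_basis RS rv; have [sP _ _] := ss.
have [/hasP[a a_s aw]|/hasPn hs] := boolP (has (fun a => ip a w < 0) s); last first.
  have wv : face ip Phi w v.
    apply: regular_faceP => // a Pa av.
    rewrite (sE w) ip_sumr big_seq sumr_ge0 // => b bs; rewrite ipZr mulr_ge0 //.
      by rewrite leNgt hs.
    exact: (root_coef_ge0 ss sv ls).
  by rewrite (cell_eq PN wv) //; exact: regular_face_sym.
have Pa := sP _ a_s; have a0 := root_nonzero RS Pa.
have [c c0 cE] := wall_crossing rv ss sv ls sE a_s.
have step : D (reflection ip a v) x <= D w x.
  have rfl b : ip b (reflection ip a v) = ip (reflection ip a b) v by rewrite ip_reflection.
  have sep b : Phi b -> 0 < ip b (reflection ip a v) -> ip b w < 0 -> 0 < ip b v /\ b != a.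
    move=> Pb bv bw; split; last first.
      apply/eqP => ba; move: bv; rewrite ba rfl reflection_self // ipNl.
      by rewrite oppr_gt0 ltNge ltW // sv.
    have /lt_total/orP[nb|//] := regular_neq0 rv Pb.
    have : 0 < ip (reflection ip a (- b)) v.
      apply: (simple_reflection_pos RS rv ss sv ls lE a_s (PN _ Pb)).
        by rewrite ipNl oppr_gt0.
      by apply: contraTneq bw => ba; rewrite -[b]opprK ba ipNl oppr_lt0 -leNgt ltW.
    by rewrite -rfl ipNl oppr_gt0 ltNge ltW.
  apply: IH.
  - apply: leq_trans cn; apply: (ltn_count (x := a)).
    + by move=> b /rsP Pb /andP[/sep h /[dup] bw /h[] // -> _].
    + by apply/rsP.
    + by rewrite sv.
    + by apply/negP => /andP[/(sep _ Pa) h /h[_]]; rewrite eqxx.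
  - exact: regular_reflection.
  - by move=> b Pb bv bw; have [? _] := sep b Pb bv bw; exact: hx.
apply: le_trans step; rewrite cE lerDl mulr_ge0 // hx // sv //.
Qed.

End Polyhedron.

(** * Degrees, semistability and balance *)

Section Degree.
Context {R : realType} {V : vectType R} (ip : {dot V for idfun}) (Phi : set V).
Variable d : set V -> 'Hom(V, R^o).
Implicit Types (a b p q u v w x y : V).
Hypothesis RS : root_system ip Phi.
Hypothesis CP : complementary_polyhedron ip Phi d.
Local Notation D v x := (d (cell ip Phi v) x : R).

Lemma polyhedron_face v w x : regular ip Phi v -> regular ip Phi w ->
  face ip Phi x v -> face ip Phi x w -> D v x = D w x.
Proof.
by move=> rv rw xv xw; apply/eqP; rewrite eq_le !(polyhedron_min RS CP).
Qed.

Lemma deg_cell p v : regular ip Phi v -> face ip Phi p v ->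
  deg ip Phi d (cell ip Phi p) = D v (facet_sum ip Phi p).
Proof.
move=> rv pv; have PN := root_opp RS.
have [s us sP] := root_seq RS; rewrite /deg /facet_sum !(sum_facet_roots RS _ _ us sP).
have : [set C | chambers ip Phi C /\ facet_ge ip (cell ip Phi p) C]
         (facet_chamber ip Phi (cell ip Phi p)).
  apply: xgetPex; exists (cell ip Phi v); split; first by apply/(chambersP ip PN); exists v.
  exact/(facet_ge_cell ip PN).
move=> [/(chambersP ip PN)[w rw ->] /(facet_ge_cell ip PN) pw].
rewrite -linear_sum /= -(sum_facet_roots RS _ _ us sP) -/(facet_sum _ _ _).
have [sp _] := facet_sum_facet RS p.
by apply: polyhedron_face => //; apply: face_trans sp _.
Qed.

Hypothesis SS : semistable ip Phi d.

(** By linearity on the closed chamber it suffices to treat a fundamental weight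
[l b]. Its facet is the ray it spans, so the vector [facet_sum] of that ray is a
positive multiple of [l b], and the degree of the ray is that multiple of
[d C (l b)]. *)
Lemma semistable_le0 v x : regular ip Phi v -> face ip Phi x v -> D v x <= 0.
Proof.
move=> rv xv; have [s [l [ss sv ls lE sE]]] := chamber_basis RS rv.
have [sP /andP[_ /free_uniq us] _] := ss.
rewrite (sE x) linear_sum big_seq sumr_le0 // => b bs; rewrite linearZ /=.
rewrite mulr_ge0_le0 //; first by apply: xv (sP _ bs) _; rewrite ltW // sv.
have lb0 : l b <> 0.
  by move=> lb; have := ls b b bs bs; rewrite lb ip0r eqxx => /eqP; rewrite eq_sym oner_eq0.
have lv : face ip Phi (l b) v by exact: (weight_face rv ss sv ls bs).
have : deg ip Phi d (cell ip Phi (l b)) <= 0.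
  apply: SS; first by exists (l b).
  by move=> c0; have := cell_self ip (root_opp RS) (l b); rewrite c0.
rewrite (deg_cell rv lv) (sE (facet_sum _ _ _)) linear_sum (bigD1_seq b) //=.
rewrite big_seq_cond big1 ?addr0 => [|c /andP[cs cb]].
  by rewrite linearZ /= pmulr_rle0 // (facet_sum_pairing RS _ (sP _ bs)).2 // ls // eqxx.
by rewrite (facet_sum_pairing RS _ (sP _ cs)).1 ?scale0r ?linear0 // ls // (negbTE cb).
Qed.

(** Expand [x] in the fundamental weights: the terms of [D v x = 0] are all
nonpositive, so [d] vanishes on each weight that occurs in [x], and only these
occur in [y]. *)
Lemma semistable_vanish v x y : regular ip Phi v -> face ip Phi x v ->
  D v x = 0 -> face ip Phi y x -> D v y = 0.
Proof.
move=> rv xv x0 yx; have [s [l [ss sv ls lE sE]]] := chamber_basis RS rv.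
have [sP _ _] := ss; have PN := root_opp RS.
have pos b : b \in s -> 0 <= ip b x by move=> bs; apply: xv (sP _ bs) _; rewrite ltW // sv.
have le0 b : b \in s -> D v (l b) <= 0.
  by move=> bs; apply: semistable_le0 => //; exact: (weight_face rv ss sv ls bs).
have zero b : b \in s -> ip b x * D v (l b) = 0.
  have : \sum_(b <- s) - (ip b x * D v (l b)) = 0.
    rewrite sumrN; move: x0; rewrite {1}(sE x) linear_sum.
    by under eq_bigr do rewrite linearZ; move=> ->; rewrite oppr0.
  move/eqP; rewrite big_seq psumr_eq0 => [/allP h bs|b' bs].
    by have := h b bs; rewrite bs oppr_eq0 => /eqP.
  by rewrite oppr_ge0 mulr_ge0_le0 // ?pos ?le0.
rewrite (sE y) linear_sum big_seq big1 // => b bs; rewrite linearZ /=.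
have /eqP := zero b bs; rewrite mulf_eq0 => /orP[/eqP bx|/eqP->]; last by rewrite scaler0.
have := yx _ (PN _ (sP _ bs)); have := yx _ (sP _ bs).
rewrite !ipNl bx oppr0 lexx oppr_ge0 => /(_ isT) h1 /(_ isT) h2.
by rewrite (_ : ip b y = 0) ?scale0r //; apply/eqP; rewrite eq_le h1 h2.
Qed.

(** No nonzero functional on the span of the values of [d] is nonnegative at all of
them: the dual form of [0] being relatively interior to their hull. *)
Definition balanced := forall x, (forall v, regular ip Phi v -> 0 <= D v x) ->
  forall v, regular ip Phi v -> D v x = 0.

(** Degree [0] means that the minimum of the values [D v x] at the point
[x = facet_sum p] is [0]; balance makes them all vanish, so [d] vanishes at [- x],
a point of the opposite facet. *)
Lemma balanced_opp p : balanced -> deg ip Phi d (cell ip Phi p) = 0 ->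
  deg ip Phi d (facet_opp (cell ip Phi p)) = 0.
Proof.
move=> bal; have [v rv pv] := regular_face RS p.
have [w rw pw] := regular_face RS (- p).
have [sp ps] := facet_sum_facet RS p; have [sn _] := facet_sum_facet RS (- p).
rewrite (facet_opp_cell RS) (deg_cell rv pv) (deg_cell rw pw) => d0.
have vs : face ip Phi (facet_sum ip Phi p) v by exact: face_trans pv.
have D0 : D w (facet_sum ip Phi p) = 0.
  apply: bal rw => u ru; rewrite -d0; exact: (polyhedron_min RS CP).
apply: (semistable_vanish rw (x := - facet_sum ip Phi p)).
- by apply: face_trans pw; apply: faceN.
- by rewrite linearN /= D0 oppr0.
- by apply: face_trans sn _; apply: faceN.
Qed.

(** If [x] pairs nonnegatively with all values of [d], then the minimum at [x] is
[0] and the facet of [x] has degree [0]. So has the opposite facet, whence the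
minimum at [- x] is [0] as well. *)
Lemma opp_balanced :
  (forall p, deg ip Phi d (cell ip Phi p) = 0 ->
     deg ip Phi d (facet_opp (cell ip Phi p)) = 0) -> balanced.
Proof.
move=> opp x xpos v rv; have [u ru xu] := regular_face RS x.
have [w rw xw] := regular_face RS (- x).
have [sx _] := facet_sum_facet RS x; have [sn' sn] := facet_sum_facet RS (- x).
have x0 : D u x = 0 by apply/eqP; rewrite eq_le xpos // semistable_le0.
have /opp : deg ip Phi d (cell ip Phi x) = 0.
  by rewrite (deg_cell ru xu); apply: semistable_vanish sx.
rewrite (facet_opp_cell RS) (deg_cell rw xw) => n0.
have nx0 : D w (- x) = 0.
  by apply: semistable_vanish sn => //; exact: face_trans sn' xw.
apply/eqP; rewrite eq_le xpos // andbT.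
by have := polyhedron_min RS CP rw rv xw; rewrite nx0 linearN oppr_ge0.
Qed.

(** A chamber is determined by the signs of the finitely many roots on it. *)
Lemma chambers_finite : finite_set (chambers ip Phi).
Proof.
have PN := root_opp RS; have [s us sP] := root_seq RS.
pose f (g : {ffun 'I_(size s) -> bool}) :=
  [set w | forall i : 'I_(size s), (0 <= ip s`_i w) = g i].
apply: (@sub_finite_set _ _ (f @` setT)); last exact: finite_image.
move=> C /(chambersP ip PN)[v rv ->]; exists [ffun i : 'I_(size s) => 0 <= ip s`_i v] => //.
apply/seteqP; split=> w /=.
  move=> h; apply/(same_facetP ip PN); split=> a /sP /(nthP 0)[i il <-];
  by have := h (Ordinal il); rewrite ffunE /= => ->.
move=> /(same_facetP ip PN)[h1 h2] i; rewrite ffunE.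
have Pi : Phi s`_i by apply/sP; exact: mem_nth.
by apply/idP/idP; [exact: h1 | exact: h2].
Qed.

Lemma relint_balanced :
  relint (dual_dot ip) (convex_hull (d @` chambers ip Phi)) 0 <-> balanced.
Proof.
have PN := root_opp RS.
have /finite_seqP[t tE] := finite_image d chambers_finite.
have [u ru] := regular_exists RS.
have memt v : regular ip Phi v -> d (cell ip Phi v) \in t.
  move=> rv; have : [set` t] (d (cell ip Phi v)); last by [].
  by rewrite -tE; exists (cell ip Phi v) => //; apply/(chambersP ip PN); exists v.
have tP f : f \in t -> exists2 v, regular ip Phi v & f = d (cell ip Phi v).
  move=> ft; have : [set` t] f by []; rewrite -tE => -[C /(chambersP ip PN)[v rv ->] <-].
  by exists v.
rewrite tE relint0P; last by apply/eqP => t0; have := memt u ru; rewrite t0.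
have dualE f l : dual_dot ip f l = f (sharp ip l) by rewrite /dual_dot sharpE.
split=> [H x xpos v rv|bal l lpos f ft].
  have := H (flat ip x) _ (d (cell ip Phi v)) (memt v rv).
  by rewrite /= dualE flatK; apply=> f /tP[w rw ->]; rewrite /= dualE flatK xpos.
have [v rv ->] := tP f ft; rewrite /= dualE; apply: bal rv => w rw.
by rewrite -dualE lpos // memt.
Qed.

End Degree.

(** * Orthogonal projections *)

Section OrthogonalProjection.
Context {R : realType} {V : vectType R} (ip : {dot V for idfun}) (W : {vspace V}).

(** The content is that [W] and its orthogonal complement span: the component of
[v] in [W] is the Riesz representative, inside [W], of the pairing with [v]. *)
Lemma ip_oproj (x : subvs_of W) v : ip (vsval x) (vsval (oproj ip W v)) = ip (vsval x) v.
Proof.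
pose O := orthov ip W; have WO : (W :&: O = 0)%VS.
  apply/eqP; rewrite -subv0; apply/subvP => u /memv_capP[uW /mem_orthovP uO].
  by rewrite memv0; apply/eqP/(ip_eq0 (ip := ip))/uO.
pose f : 'Hom(subvs_of W, R^o) := linfun ((ip v \o vsval) : subvs_of W -> R^o).
pose u := sharp (sub_dot ip W) f.
have uE (y : subvs_of W) : ip (vsval u) (vsval y) = ip v (vsval y).
  by have := sharpE (sub_dot ip W) f y; rewrite lfunE.
have vu : v - vsval u \in O.
  apply/mem_orthovP => w wW; have := uE (vsproj W w); rewrite vsprojK // => wE.
  by have : ip (v - vsval u) w = 0 by rewrite ipDl ipNl wE subrr.
have := daddv_pi_add (w := v) WO _; rewrite -{1}(subrKC (vsval u) v) memv_add ?subvsP //.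
move=> /(_ isT) vE; rewrite /oproj vsprojK ?memv_pi // -[in RHS]vE ipDr.
by have /mem_orthovP h := memv_pi O W v; rewrite [X in _ + X]ipC h ?addr0 ?subvsP.
Qed.

Lemma oproj_eq (x : subvs_of W) v :
  (forall y : subvs_of W, ip (vsval y) v = ip (vsval y) (vsval x)) -> oproj ip W v = x.
Proof.
move=> h; apply/eqP; rewrite -subr_eq0; apply/eqP/(ip_eq0 (ip := sub_dot ip W)).
set y := _ - x; suff yE (z : subvs_of W) : ip (vsval z) (vsval y) = 0 by exact: yE.
have -> : vsval y = vsval (oproj ip W v) - vsval x by rewrite /y linearB.
by rewrite ipDr ipNr ip_oproj h subrr.
Qed.

Lemma dual_oprojE (f : 'Hom(V, R^o)) x : dual_oproj ip W f x = f (vsval x).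
Proof.
rewrite /dual_oproj flatE /= /sub_dot (ipC ip) ip_oproj (ipC ip).
exact: sharpE.
Qed.

End OrthogonalProjection.

(** * The Levi factor of a facet *)

Section Levi.
Context {R : realType} {V : vectType R} (ip : {dot V for idfun}) (Phi : set V).
Variable (p : V).
Hypothesis RS : root_system ip Phi.
Local Notation P := (cell ip Phi p).
Local Notation W := (perp ip P).
Local Notation ipW := (sub_dot ip W).
Local Notation PhiW := (levi_roots ip Phi P).
Implicit Types (v w : V) (x y u : subvs_of W).

Lemma perp_cell x : ip (vsval x) p = 0.
Proof. by have /perpP := subvsP x; apply; exact: cell_self (root_opp RS) p. Qed.

Lemma root_in_perp a : Phi a -> ip a p = 0 -> a \in W.
Proof.
move=> Pa ap; apply/perpP => w /(same_facetP ip (root_opp RS))[_ wp].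
have := wp _ Pa; have := wp _ (root_opp RS Pa).
by rewrite !ipNl ap oppr0 lexx oppr_ge0 => /(_ isT) h /(_ isT) h'; apply/eqP; rewrite eq_le h.
Qed.

Lemma levi_root_lift a : Phi a -> ip a p = 0 -> exists2 b : subvs_of W, PhiW b & vsval b = a.
Proof.
by move=> Pa ap; exists (vsproj W a); rewrite /levi_roots /= vsprojK // root_in_perp.
Qed.

Lemma vsval_reflection (a b : subvs_of W) :
  vsval (reflection ipW a b) = reflection ip (vsval a) (vsval b).
Proof. by rewrite /reflection linearB linearZ. Qed.

(** Spanning is the part that uses the geometry: the simple roots, of a chamber
with [P] in its closure, that vanish on [P] span the orthogonal space of [P],
because a vector orthogonal to [P] is orthogonal to the weights dual to the other
simple roots, along which [P] extends. *)
Lemma levi_root_system : root_system ipW PhiW.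
Proof.
split.
- apply: finite_preimage; last exact: root_finite RS.
  by move=> x y _ _; exact: val_inj.
- move=> P0; apply: (root_neq0 RS).
  by have <- : vsval (0 : subvs_of W) = 0 by rewrite linear0.
- move=> x; have [v rv pv] := regular_face RS p.
  have [s [l [ss sv ls lE sE]]] := chamber_basis RS rv; have [sP _ _] := ss.
  pose t := [seq b <- s | ip b p == 0].
  have tW b : b \in t -> b \in W.
    by rewrite mem_filter => /andP[/eqP bp /sP Pb]; exact: root_in_perp.
  exists [seq vsproj W b | b <- t].
    move=> _ /= /mapP[b bt ->]; rewrite /levi_roots /= vsprojK ?tW //.
    by move: bt; rewrite mem_filter => /andP[_ /sP].
  rewrite -(vsvalK x) (lE (vsval x)) big_seq.
  rewrite (bigID (fun b => ip b p == 0)) /= [X in _ + X]big1 ?addr0 => [|b /andP[bs bp]].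
    rewrite linear_sum rpred_sum // => b /andP[bs bp]; rewrite linearZ rpredZ //.
    by rewrite memv_span // map_f // mem_filter bp.
  suff -> : ip (vsval x) (l b) = 0 by rewrite scale0r.
  have PN := root_opp RS.
  have lp : ip (vsval x) (p + l b) = 0.
    have /perpP := subvsP x; apply; apply/(same_facetP ip PN).
    have [_ lp] := weight_face_facet RS rv pv ss sv ls sE bs bp.
    split=> a Pa; rewrite ipDr => h; last by rewrite addr_ge0 ?lp.
    rewrite leNgt; apply/negP => ap; have := lp _ (PN _ Pa).
    by rewrite !ipNl !oppr_ge0 (ltW ap) => /(_ isT); lra.
  by move: lp; rewrite ipDr perp_cell add0r.
- move=> a b Pa Pb; have := root_reflection RS Pa Pb.
  by rewrite -vsval_reflection.
- by move=> a b Pa Pb; exact: (root_crystallographic RS Pa Pb).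
- move=> a k Pa; have kE : vsval (k *: a) = k *: vsval a by rewrite linearZ.
  by rewrite /levi_roots /mkset kE => Pk; exact: (root_reduced RS Pa Pk).
Qed.

Local Notation cellW := (cell ipW PhiW).
Local Notation faceW := (face ipW PhiW).

(** The chamber of [v] has [P] in its closure and projects onto the chamber of
[u] (see [lift_exists]). *)
Definition lift v u := [/\ regular ip Phi v, face ip Phi p v &
  forall a, PhiW a -> (0 <= ip (vsval a) v) = (0 <= ip (vsval a) (vsval u))].

(** Roots that do not vanish on [p] are controlled by the multiple of [p], the
others are roots of the Levi factor and do not see it. *)
Lemma lift_face x : exists T : R,
  forall v u, lift v u -> faceW x u -> face ip Phi (T *: p + vsval x) v.
Proof.
have [s us sP] := root_seq RS; have [T h] := perturb ip s p (vsval x).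
exists T => v u [rv pv vu] xu a Pa av.
have := pv a Pa av; rewrite le_eqVlt => /orP[/eqP/esym ap|ap]; last first.
  by rewrite ltW // h //; apply/sP.
rewrite ipDr ipZr ap mulr0 add0r; have [b Pb ba] := levi_root_lift Pa ap.
by move: av; rewrite -ba vu //; exact: xu.
Qed.

Lemma lift_unique v w u : lift v u -> lift w u -> cell ip Phi v = cell ip Phi w.
Proof.
have PN := root_opp RS.
suff key v' w' : lift v' u -> lift w' u -> face ip Phi v' w'.
  by move=> vu wu; apply: cell_eq => //; exact: key.
move=> [rv pv vu] [rw pw wu] a Pa aw.
have [ap|ap] := eqVneq (ip a p) 0.
  by have [b Pb ba] := levi_root_lift Pa ap; rewrite -ba vu // -wu // ba.
rewrite leNgt; apply/negP => av; have := pv _ (PN _ Pa); rewrite !ipNl !oppr_ge0 ltW //.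
by move=> /(_ isT) ap'; have := pw a Pa aw; rewrite leNgt lt_neqAle ap ap'.
Qed.

(** The lift is the chamber of [T *: p + vsval u] for large [T]. Its projection is
all of the chamber of [u], because any [x] there has a preimage of the same form
for a constant [T'] of its own. *)
Lemma lift_exists u : regular ipW PhiW u ->
  exists2 v, lift v u & oproj ip W @` cell ip Phi v = cellW u.
Proof.
move=> ru; have PN := root_opp RS; have PNW := root_opp levi_root_system.
have reg a : Phi a -> ip a p = 0 -> forall x, cellW u x -> ip a (vsval x) != 0.
  move=> Pa /(levi_root_lift Pa)[b Pb <-] x /(cell_regular ru) rx.
  exact: regular_neq0 rx Pb.
have lft x T : cellW u x -> regular ip Phi (T *: p + vsval x) ->
    face ip Phi p (T *: p + vsval x) -> lift (T *: p + vsval x) u.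
  move=> /(same_facetP ipW PNW)[ux xu] rx px; split=> // a Pa.
  rewrite ipDr ipZr perp_cell mulr0 add0r; apply/idP/idP => [/(ux a Pa)//|/(xu a Pa)//].
have uu : cellW u u by exact: cell_self.
have [T rv pv] := regular_near RS (fun a Pa ap => reg a Pa ap u uu).
set v := _ + _ in rv pv; have vu : lift v u by exact: lft.
exists v => //; apply/seteqP; split=> [_ [w wv <-] a Pa|x ux].
  have := wv _ Pa; rewrite /= /sub_dot !ip_oproj.
  by rewrite /v ipDr ipZr perp_cell mulr0 add0r.
have [T' rw pw] := regular_near RS (fun a Pa ap => reg a Pa ap x ux).
exists (T' *: p + vsval x); last first.
  by apply: oproj_eq => y; rewrite ipDr ipZr perp_cell mulr0 add0r.
by rewrite (lift_unique vu (lft _ _ ux rw pw)); exact: cell_self.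
Qed.

Lemma levi_chamberP u : regular ipW PhiW u ->
  exists2 v, lift v u & levi_chamber Phi (cellW u) = cell ip Phi v.
Proof.
move=> ru; have PN := root_opp RS; have PNW := root_opp levi_root_system.
have [v [rv pv vu] vE] := lift_exists ru.
have : [set C | [/\ chambers ip Phi C, facet_ge ip P C & oproj ip W @` C = cellW u]]
    (levi_chamber Phi (cellW u)).
  apply: xgetPex; exists (cell ip Phi v); split=> //; first by apply/(chambersP ip PN); exists v.
  exact/(facet_ge_cell ip PN).
move=> [/(chambersP ip PN)[w rw ->] /(facet_ge_cell ip PN) pw wE]; exists w => //.
split=> // a Pa; have : cellW u (oproj ip W w).
  by rewrite -wE; exists w => //; exact: cell_self.
move=> /(same_facetP ipW PNW)[uw wu].
by rewrite -[in LHS]ip_oproj; apply/idP/idP => [/(uw a Pa)//|/(wu a Pa)//].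
Qed.

Variable d : set V -> 'Hom(V, R^o).
Hypothesis CP : complementary_polyhedron ip Phi d.
Local Notation dW := (levi ip Phi d P).

(** For (A1), evaluate [d] at [T *: p + vsval x], which lies in the closures of
both lifted chambers, and cancel the contribution of [p]. For (A2), the
reflection in a root orthogonal to [P] fixes [p] and so maps the lift of a chamber
to the lift of its mirror image. *)
Lemma levi_complementary_polyhedron : complementary_polyhedron ipW PhiW dW.
Proof.
have PN := root_opp RS; have RSW := levi_root_system; have PNW := root_opp RSW.
split=> [C D x|C D a] /(chambersP ipW PNW)[u ru ->] /(chambersP ipW PNW)[u' ru' ->].
  move=> [_ /(cl_cell ipW PNW) xu] [_ /(cl_cell ipW PNW) xu'].
  have [v vu vE] := levi_chamberP ru; have [w wu wE] := levi_chamberP ru'.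
  rewrite /levi !dual_oprojE vE wE; have [T h] := lift_face x.
  have [rv pv _] := vu; have [rw pw _] := wu.
  have := polyhedron_face RS CP rv rw (h _ _ vu xu) (h _ _ wu xu').
  by rewrite !linearD !linearZ /= (polyhedron_face RS CP rv rw pv pw) => /addrI.
move=> Pa [up _ uu']; have [v vu vE] := levi_chamberP ru; have [w wu wE] := levi_chamberP ru'.
rewrite /levi !dual_oprojE vE wE; have [rv pv vs] := vu; have [rw pw ws] := wu.
have a0 := root_nonzero RS Pa.
have av : 0 < ip (vsval a) v.
  have au := up u (cell_self ipW PNW u).
  by rewrite lt0r (regular_neq0 rv Pa) vs //; exact: ltW au.
have rv' : regular ip Phi (reflection ip (vsval a) v) by exact: regular_reflection.
have wv : lift (reflection ip (vsval a) v) u'.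
  split=> // [|b Pb].
    have aPhi b : Phi b -> Phi (reflection ip (vsval a) b).
      exact: (root_reflection RS).
    have := face_reflection a0 aPhi pv.
    by rewrite (reflection_fixed (perp_cell a)).
  have : cellW u' (reflection ipW a u).
    by rewrite uu'; exists u => //; exact: cell_self.
  move=> /(same_facetP ipW PNW)[h1 h2].
  have E : ip (vsval b) (vsval (reflection ipW a u)) =
           ip (vsval (reflection ipW a b)) (vsval u).
    by rewrite !vsval_reflection ip_reflection.
  have Prb : PhiW (reflection ipW a b) by exact: (root_reflection RSW).
  rewrite -ip_reflection // -vsval_reflection vs // -E.
  by apply/idP/idP => [/(h1 b Pb)//|/(h2 b Pb)//].
rewrite (lift_unique wu wv); have [_ A2] := CP; apply: A2 => //.
- by apply/(chambersP ip PN); exists v.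
- by apply/(chambersP ip PN); exists (reflection ip (vsval a) v).
- exact: conjugate_cells.
Qed.

(** The degree of a facet of the Levi factor is the value of [d] at a vector [y];
[d] vanishes at [p] and is nonpositive at [T *: p + vsval y], a point of the closed
lifted chamber. *)
Lemma levi_semistable : semistable ip Phi d -> deg ip Phi d P = 0 ->
  semistable ipW PhiW dW.
Proof.
move=> SS d0 _ [q ->] _; have RSW := levi_root_system.
have [u ru qu] := regular_face RSW q.
have [v vu vE] := levi_chamberP ru; have [rv pv _] := vu.
rewrite -/(cellW q) (deg_cell RSW levi_complementary_polyhedron ru qu).
rewrite /levi dual_oprojE vE; set y := facet_sum _ _ _.
have yu : faceW y u by apply: face_trans qu; have [] := facet_sum_facet RSW q.
have [T h] := lift_face y.
have := semistable_le0 RS CP SS rv (h _ _ vu yu); rewrite linearD linearZ /=.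
have [sp ps] := facet_sum_facet RS p.
have := d0; rewrite (deg_cell RS CP rv pv) => s0.
have -> : d (cell ip Phi v) p = 0.
  by apply: (semistable_vanish RS CP SS rv _ s0 ps); exact: face_trans sp pv.
by rewrite scaler0 add0r.
Qed.

End Levi.

Theorem lemma2p5p9 (R : realType) (V : vectType R) (ip : {dot V for idfun})
    (Phi : set V) (d : set V -> 'Hom(V, R^o)) :
  root_system ip Phi ->
  complementary_polyhedron ip Phi d ->
  semistable ip Phi d ->
  (polystable ip Phi d <->
   relint (dual_dot ip) (convex_hull (d @` chambers ip Phi)) 0).
Proof.
move=> RS CP SS; rewrite relint_balanced //; split=> [PS|bal _ [p ->] p0].
  apply: (opp_balanced RS CP SS) => p p0.
  have Pp : facets ip Phi (cell ip Phi p) by exists p.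
  by have [] := PS _ Pp p0.
split.
- exact: levi_complementary_polyhedron.
- exact: levi_semistable.
- exact: (balanced_opp RS CP SS bal p0).
Qed.
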